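(* Let $v^{\mathrm{in}}\in\mathbb{L}^2(\mathcal{O})$, let $v^\ell_{\mathcal{D}}=\mathfrak{S}(\ell,v^{\mathrm{in}})$ and $v^{\ell+1/2}_{\mathcal{D}}=\mathfrak{S}^{1/2}(\ell,v^{\mathrm{in}})$, and, for $N\in\mathbb{N}$ and Borel sets $A\subset\mathbb{L}^2(\mathcal{O})$, let $$\mu^{1/2,N}_{\tau,\mathcal{D}}(v^{\mathrm{in}};A)=\frac1N\sum_{n=0}^{N-1}\mathbb{P}\big(\Pi_{\mathcal{D}}\mathfrak{S}^{1/2}(n,v^{\mathrm{in}})\in A\big).$$ For all Lipschitz-continuous $f\in C_b(\mathbb{L}^2(\mathcal{O}))$ there exists a constant $C_f$ such that for all $n,N\in\mathbb{N}$: $$\left|\int_{\mathbb{L}^2(\mathcal{O})}\mathcal{P}^n_{\tau,\mathcal{D}}f(v)\,\mu^{1/2,N}_{\tau,\mathcal{D}}(v^{\mathrm{in}};dv)-\int_{\mathbb{L}^2(\mathcal{O})}f(v)\,\mu^{1/2,N}_{\tau,\mathcal{D}}(v^{\mathrm{in}};dv)\right|\le C_f\left(\frac nN+\sqrt{\mathbb{E}\left[\frac1N\sum_{\ell=0}^{N-1}\|\Pi_{\mathcal{D}}v^{\ell+1/2}_{\mathcal{D}}-\Pi_{\mathcal{D}}v^\ell_{\mathcal{D}}\|_{L^2(\mathcal{O})}^2\right]}\right).$$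
   Context: Setting. $(\Omega,(\mathcal{F}_t)_{t\ge0},\mathcal{F},\mathbb{P})$ is a filtered probability space satisfying the usual conditions and $W$ is a real-valued $(\mathcal{F}_t)$-Wiener process. $\mathcal{O}\subset\mathbb{R}^d$ is a bounded polygonal domain. $p\in(1,\infty)$, $p'=p/(p-1)$, $p\wedge p'=\min(p,p')$, $\kappa\ge0$. For $A\in\mathbb{R}^{d\times d}$ (with Euclidean norm $|A|$), $S(A)=(\kappa+|A|^2)^{(p-2)/2}A$ (with $S(0)=0$). $\mathbb{L}^2(\mathcal{O})$ is the space of $L^2$ vector fields $\mathcal{O}\to\mathbb{R}^d$, and $C_b(\mathbb{L}^2(\mathcal{O}))$ the space of (norm-)continuous bounded real functions on it; $(\cdot,\cdot)$ is the $L^2(\mathcal{O})$ pairing $\int_{\mathcal{O}}$ of (scalar, vector or matrix) functions. $\mathbb{W}^{k,\infty}_{\mathrm{div}}(\mathcal{O})$ is the $W^{k,\infty}$-closure of smooth vector fields on $\mathcal{O}$ with zero divergence. The data are deterministic and time-independent: $g\in\mathbb{W}^{2,\infty}_{\mathrm{div}}(\mathcal{O})$, $\sigma\in\mathbb{W}^{1,\infty}_{\mathrm{div}}(\mathcal{O})$. $\varepsilon g=\tfrac12(\nabla g+(\nabla g)^T)$ and $(\sigma\cdot\nabla)g=\sum_j\sigma_j\partial_jg$. Gradient Discretisation (GD). $\mathcal{D}=(X_{\mathcal{D},0},Y_{\mathcal{D}},\nabla_{\mathcal{D}},\varepsilon_{\mathcal{D}},\chi_{\mathcal{D}},\mathrm{div}_{\mathcal{D}},\Pi_{\mathcal{D}})$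 where $X_{\mathcal{D},0},Y_{\mathcal{D}}$ are finite-dimensional real vector spaces; $\nabla_{\mathcal{D}},\varepsilon_{\mathcal{D}}:X_{\mathcal{D},0}\to L^p(\mathcal{O})^{d\times d}$, $\mathrm{div}_{\mathcal{D}}:X_{\mathcal{D},0}\to L^p(\mathcal{O})$, $\Pi_{\mathcal{D}}:X_{\mathcal{D},0}\to L^2(\mathcal{O})^d$, $\chi_{\mathcal{D}}:Y_{\mathcal{D}}\to L^{p\wedge p'}(\mathcal{O})$ are linear; $\nabla_{\mathcal{D}},\varepsilon_{\mathcal{D}},\mathrm{div}_{\mathcal{D}},\Pi_{\mathcal{D}}$ moreover take values in $L^p\cap L^{p'}$, so that all pairings and constants below make sense. $\|\varepsilon_{\mathcal{D}}\cdot\|_{L^p(\mathcal{O})}$ is a norm on $X_{\mathcal{D},0}$. With $Y_{\mathcal{D},0}=\{q\in Y_{\mathcal{D}}:\int_{\mathcal{O}}\chi_{\mathcal{D}}q\,dx=0\}$, $\|\chi_{\mathcal{D}}\cdot\|_{L^{p\wedge p'}(\mathcal{O})}$ is a norm on $Y_{\mathcal{D},0}$. $E_{\mathcal{D},0}=\{v\in X_{\mathcal{D},0}:(\chi_{\mathcal{D}}q,\mathrm{div}_{\mathcal{D}}v)=0\ \forall q\in Y_{\mathcal{D},0}\}$, and $\Pi_{\mathcal{D}}$ is one-to-one on $E_{\mathcal{D},0}$. The $L^2$-projection $\mathcal{K}_{\mathcal{D}}:\mathbb{L}^2(\mathcal{O})\to E_{\mathcal{D},0}$ is defined by $(u-\Pi_{\mathcal{D}}\mathcal{K}_{\mathcal{D}}u,\Pi_{\mathcal{D}}\xi)=0$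 for all $\xi\in E_{\mathcal{D},0}$. For $r\in\{p,p'\}$ put $C_{\mathcal{D}}(r)=\sup_{v\in X_{\mathcal{D},0}\setminus\{0\}}\frac{\|\Pi_{\mathcal{D}}v\|_{L^r}+\|\mathrm{div}_{\mathcal{D}}v\|_{L^r}+\|\nabla_{\mathcal{D}}v\|_{L^r}}{\|\varepsilon_{\mathcal{D}}v\|_{L^r}}$, $C^{\mathrm{Sob}}_{\mathcal{D}}(r)=\sup_{z\in W^{1,r}(\mathcal{O})^d\setminus\{0\}}\frac{\|\varepsilon_{\mathcal{D}}\mathcal{K}_{\mathcal{D}}z\|_{L^r}}{\|z\|_{W^{1,r}}}$, and $\beta_{\mathcal{D}}(p)=\inf_{q\in Y_{\mathcal{D},0}\setminus\{0\}}\sup_{v\in X_{\mathcal{D},0}\setminus\{0\}}\frac{(\chi_{\mathcal{D}}q,\mathrm{div}_{\mathcal{D}}v)}{\|\chi_{\mathcal{D}}q\|_{L^{p\wedge p'}}(\|\varepsilon_{\mathcal{D}}v\|_{L^p}+\|\varepsilon_{\mathcal{D}}v\|_{L^{p'}})}$. Standing assumption: $\mathcal{D}$ is $\Gamma$-stable, i.e. for some $\Gamma\in[1,\infty)$: $C_{\mathcal{D}}(p)+C_{\mathcal{D}}(p')\le\Gamma$, $\beta_{\mathcal{D}}(p)\ge\Gamma^{-1}$, $C^{\mathrm{Sob}}_{\mathcal{D}}(p)+C^{\mathrm{Sob}}_{\mathcal{D}}(p')\le\Gamma$. Discrete noise form: $B^\sigma_{\mathcal{D}}(v,\xi)=\tfrac12(\sigma^T\nabla_{\mathcal{D}}v,\Pi_{\mathcal{D}}\xi)-\tfrac12(\Pi_{\mathcal{D}}v,\sigma^T\nabla_{\mathcal{D}}\xi)$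 for $v,\xi\in X_{\mathcal{D},0}$, where $(\sigma^T\nabla_{\mathcal{D}}v)_i=\sum_j\sigma_j(\nabla_{\mathcal{D}}v)_{ji}$ is the discrete counterpart of $(\sigma\cdot\nabla)v$. Algorithm. Given $v^{\mathrm{in}}\in\mathbb{L}^2(\mathcal{O})$ and a fixed time step $\tau>0$, $t_n=n\tau$, $\Delta_{n+1}W=W(t_{n+1})-W(t_n)$. Step 1 (initialisation): $(v^0_{\mathcal{D}},\pi^0_{\mathcal{D}})\in X_{\mathcal{D},0}\times Y_{\mathcal{D},0}$ solves $(\Pi_{\mathcal{D}}v^0_{\mathcal{D}},\Pi_{\mathcal{D}}\xi)+(\chi_{\mathcal{D}}\pi^0_{\mathcal{D}},\mathrm{div}_{\mathcal{D}}\xi)=(v^{\mathrm{in}},\Pi_{\mathcal{D}}\xi)$ for all $\xi\in X_{\mathcal{D},0}$ and $(\mathrm{div}_{\mathcal{D}}v^0_{\mathcal{D}},\chi_{\mathcal{D}}q)=0$ for all $q\in Y_{\mathcal{D},0}$. Step 2 (time-stepping): for $n\in\mathbb{N}_0$, $(v^{n+1}_{\mathcal{D}},\pi^{n+1}_{\mathcal{D}})\in X_{\mathcal{D},0}\times Y_{\mathcal{D},0}$ satisfies $\mathbb{P}$-a.s. for all $(\xi,q)\in X_{\mathcal{D},0}\times Y_{\mathcal{D},0}$ $$(\Pi_{\mathcal{D}}v^{n+1}_{\mathcal{D}}-\Pi_{\mathcal{D}}v^n_{\mathcal{D}},\Pi_{\mathcal{D}}\xi)+\tau(S(\varepsilon_{\mathcal{D}}v^{n+1/2}_{\mathcal{D}}+\varepsilon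 g),\varepsilon_{\mathcal{D}}\xi)-(\chi_{\mathcal{D}}\pi^{n+1}_{\mathcal{D}}-\chi_{\mathcal{D}}\pi^n_{\mathcal{D}},\mathrm{div}_{\mathcal{D}}\xi)=[B^\sigma_{\mathcal{D}}(v^{n+1/2}_{\mathcal{D}},\xi)+((\sigma\cdot\nabla)g,\Pi_{\mathcal{D}}\xi)]\Delta_{n+1}W,$$ $$(\mathrm{div}_{\mathcal{D}}v^{n+1/2}_{\mathcal{D}},\chi_{\mathcal{D}}q)=0,\qquad v^{n+1/2}_{\mathcal{D}}=\tfrac12(v^{n+1}_{\mathcal{D}}+v^n_{\mathcal{D}}).$$ The algorithm is well-posed (unique solutions). Solution operators: $\mathfrak{S}(n,v^{\mathrm{in}}):=v^n_{\mathcal{D}}\in E_{\mathcal{D},0}$, the velocity at index $n$ when initialised in $v^{\mathrm{in}}$, and $\mathfrak{S}^{1/2}(n,v^{\mathrm{in}}):=\tfrac12(\mathfrak{S}(n+1,v^{\mathrm{in}})+\mathfrak{S}(n,v^{\mathrm{in}}))$. Discrete transition semigroup: $(\mathcal{P}^n_{\tau,\mathcal{D}}f)(v^{\mathrm{in}})=\mathbb{E}[f(\Pi_{\mathcal{D}}\mathfrak{S}(n,v^{\mathrm{in}}))]$ for $n\in\mathbb{N}_0$, $f\in C_b(\mathbb{L}^2(\mathcal{O}))$, $v^{\mathrm{in}}\in\mathbb{L}^2(\mathcal{O})$. *)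

(* Defs.v *)
From HB Require Import structures.
From mathcomp Require Import all_boot all_order all_algebra.
From mathcomp Require Import all_classical all_reals all_analysis.
From mathcomp Require Import measurable_realfun ring lra.

Set Implicit Arguments.
Unset Strict Implicit.
Unset Printing Implicit Defensive.
Import Order.TTheory GRing.Theory Num.Theory.
Import numFieldNormedType.Exports.

Local Open Scope classical_set_scope.
Local Open Scope ring_scope.

(** Matrices, and in particular row vectors, carry their Borel sigma-algebra. *)
HB.instance Definition _ (R : realType) (m n : nat) :=
  @isMeasurable.Build (sigma_display (@open 'M[R]_(m, n))) 'M[R]_(m, n)
    <<s @open 'M[R]_(m, n) >> (@sigma_algebra0 _ setT _) (@sigma_algebraC _ _)
    (@sigma_algebra_bigcup _ setT _).

Lemma open_measurable_mx (R : realType) m n (A : set 'M[R]_(m, n)) :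
  open A -> measurable A.
Proof. exact: sub_sigma_algebra. Qed.

Lemma measurable_entry (R : realType) m n (i : 'I_m) (j : 'I_n) :
  measurable_fun [set: 'M[R]_(m, n)] (fun A => A i j).
Proof.
apply: (measurability _ (RGenOInfty.measurableE R)) => _ [_ [a ->] <-].
rewrite setTI; apply: open_measurable_mx.
apply: open_comp => [A _|]; [exact: coord_continuous|exact: interval_open].
Qed.

Lemma measurable_fun_mx (R : realType) d (T : measurableType d) m n
    (f : T -> 'M[R]_(m, n)) :
  (forall i j, measurable_fun [set: T] (fun x => f x i j)) ->
  measurable_fun [set: T] f.
Proof.
move=> mf; apply: (measurability (rT := 'M[R]_(m, n)) _ erefl).
move=> _ [U oU <-]; rewrite setTI.
pose c (q : 'M[rat]_(m, n)) : 'M[R]_(m, n) := map_mx ratr q.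
pose B (kq : nat * 'M[rat]_(m, n)) : set 'M[R]_(m, n) :=
  ball (c kq.2) (kq.1.+1%:R^-1).
have -> : f @^-1` U = \bigcup_(kq in [set kq | B kq `<=` U]) (f @^-1` B kq).
  apply/seteqP; split => [x Ux|x [kq BU Bx]]; last exact: BU.
  have /nbhs_ballP[e /= e0 eU] : nbhs (f x) U by exact: open_nbhs_nbhs.
  have [k ke] : exists k : nat, k.+1%:R^-1 < e / 2.
    exists (Num.truncn (e / 2)^-1); rewrite invf_plt ?posrE ?divr_gt0//.
    by rewrite truncnS_gt.
  have k0 : 0 < k.+1%:R^-1 :> R by rewrite invr_gt0.
  have [q qf] : exists q : 'M[rat]_(m, n), ball (f x) (k.+1%:R^-1) (c q).
    have /choice[q Hq] : forall ij : 'I_m * 'I_n,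
        exists q : rat, ball (f x ij.1 ij.2) (k.+1%:R^-1) (ratr q : R).
      move=> ij.
      have [||y [By [q _ qy]]] :=
        @dense_rat R (ball (f x ij.1 ij.2) k.+1%:R^-1).
      - by exists (f x ij.1 ij.2); exact: ballxx.
      - exact: ball_open.
      - by exists q; rewrite qy.
    exists (\matrix_(i, j) q (i, j)); split => // i j.
    by rewrite !mxE; exact: (Hq (i, j)).
  exists (k, q) => /=; last exact: ball_sym.
  move=> z qz; apply: eU; rewrite (splitr e).
  apply: (@ball_triangle _ _ (c q)); apply: le_ball (ltW ke) _ _ => //.
rewrite bigcup_mkcond.
apply: countable_bigcupT_measurable => [|[k q]]; first exact: countableP.
case: ifPn => // _.
have -> : f @^-1` B (k, q) = \bigcap_ij
    [set x | ball (c q ij.1 ij.2) k.+1%:R^-1 (f x ij.1 ij.2)].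
  apply/seteqP; split => [x [_ Bx] [i j] _|x Bx]; first exact: Bx.
  by split => [|i j]; [rewrite invr_gt0|exact: (Bx (i, j))].
apply: fin_bigcap_measurable => // -[i j] _ /=.
rewrite -[X in measurable X]setTI.
apply: (mf i j measurableT (ball (c q i j : R) k.+1%:R^-1)).
by apply: open_measurable; exact: ball_open.
Qed.

Section lebesgue_rV.
Variable R : realType.

Definition row_cons n (xy : R * 'rV[R]_n) : 'rV[R]_n.+1 :=
  \row_j oapp (xy.2 ord0) xy.1 (unlift ord0 j).

Lemma measurable_row_cons n :
  measurable_fun [set: R * 'rV[R]_n] (@row_cons n).
Proof.
apply: measurable_fun_mx => i j; rewrite /row_cons.
under eq_fun do rewrite mxE.
case: unliftP => [k _|_] /=; last exact: measurable_fst.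
exact: (measurableT_comp (measurable_entry ord0 k) measurable_snd).
Qed.

Section lebesgue_rV_succ.
Variables (n : nat) (mu : {measure set 'rV[R]_n -> \bar R}).

(** The product of Lebesgue measure on the line with [mu]. *)
Definition lebesgue_rV_succ : set 'rV[R]_n.+1 -> \bar R :=
  pushforward (@lebesgue_measure R \x^ mu)%E (@row_cons n).

Let lebesgue_rV_succ0 : lebesgue_rV_succ set0 = 0%E.
Proof. by rewrite /lebesgue_rV_succ /pushforward preimage_set0 measure0. Qed.

Let lebesgue_rV_succ_ge0 A : (0 <= lebesgue_rV_succ A)%E.
Proof. by rewrite /lebesgue_rV_succ /pushforward measure_ge0. Qed.

Let lebesgue_rV_succ_sigma_additive : semi_sigma_additive lebesgue_rV_succ.
Proof.
have mpre A : measurable A -> measurable (@row_cons n @^-1` A).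
  by move=> mA; rewrite -[X in measurable X]setTI; exact: measurable_row_cons.
move=> F mF tF mUF; rewrite /lebesgue_rV_succ /pushforward preimage_bigcup.
apply: measure_semi_sigma_additive => [k||]; first exact: mpre.
- apply/trivIsetP => i j _ _ ij; rewrite -preimage_setI.
  by move/trivIsetP : tF => /(_ i j Logic.I Logic.I ij) ->; rewrite preimage_set0.
- by rewrite -preimage_bigcup; exact: mpre.
Qed.

HB.instance Definition _ := isMeasure.Build _ _ _ lebesgue_rV_succ
  lebesgue_rV_succ0 lebesgue_rV_succ_ge0 lebesgue_rV_succ_sigma_additive.

End lebesgue_rV_succ.

Fixpoint lebesgue_rV n : {measure set 'rV[R]_n -> \bar R} :=
  if n is n'.+1 then lebesgue_rV_succ (lebesgue_rV n') else \d_(0 : 'rV[R]_0).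

End lebesgue_rV.

Section euclidean.
Variables (R : realType) (m n : nat).
Implicit Types A B : 'M[R]_(m, n).

Definition mxdot A B : R := \sum_i \sum_j A i j * B i j.

(** The library norm of a matrix is the sup norm; this is the Euclidean one. *)
Definition enorm A : R := Num.sqrt (mxdot A A).

Lemma mxdotC A B : mxdot A B = mxdot B A.
Proof. by apply: eq_bigr => i _; apply: eq_bigr => j _; rewrite mulrC. Qed.

Lemma mxdotDl A B C : mxdot (A + B) C = mxdot A C + mxdot B C.
Proof.
rewrite -big_split; apply: eq_bigr => i _ /=; rewrite -big_split.
by apply: eq_bigr => j _; rewrite mxE mulrDl.
Qed.

Lemma mxdotZl c A B : mxdot (c *: A) B = c * mxdot A B.
Proof.
rewrite mulr_sumr; apply: eq_bigr => i _; rewrite mulr_sumr.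
by apply: eq_bigr => j _; rewrite mxE mulrA.
Qed.

Lemma mxdot_ge0 A : 0 <= mxdot A A.
Proof. by apply: sumr_ge0 => i _; apply: sumr_ge0 => j _; rewrite -expr2 sqr_ge0. Qed.

Lemma enorm_ge0 A : 0 <= enorm A. Proof. exact: sqrtr_ge0. Qed.

Lemma enorm_sqr A : enorm A ^+ 2 = mxdot A A.
Proof. by rewrite sqr_sqrtr// mxdot_ge0. Qed.

Lemma enorm0 : enorm 0 = 0.
Proof. by rewrite /enorm -[X in mxdot X](scale0r 0) mxdotZl mul0r sqrtr0. Qed.

Lemma enormN A : enorm (- A) = enorm A.
Proof. by rewrite /enorm -scaleN1r mxdotZl mxdotC mxdotZl mulrA mulrNN !mul1r. Qed.

Lemma enorm_eq0 A : enorm A = 0 -> A = 0.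
Proof.
move=> A0; have : mxdot A A == 0 by rewrite -enorm_sqr A0 expr0n.
rewrite psumr_eq0 => [/allP Ai0|i _]; last first.
  by apply: sumr_ge0 => j _; rewrite -expr2 sqr_ge0.
apply/matrixP => i j; rewrite mxE.
have := Ai0 i (mem_index_enum i).
rewrite psumr_eq0 => [/allP/(_ j (mem_index_enum j))|k _]; last first.
  by rewrite -expr2 sqr_ge0.
by rewrite -expr2 sqrf_eq0 => /eqP.
Qed.

Lemma mxdot_le A B : mxdot A B <= enorm A * enorm B.
Proof.
have [B0|B0] := eqVneq (enorm B) 0.
  by rewrite (enorm_eq0 B0) mxdotC -(scale0r A) mxdotZl mul0r mulr_ge0 ?enorm_ge0.
have {}B0 : 0 < enorm B ^+ 2 by rewrite exprn_gt0// lt_neqAle eq_sym B0 enorm_ge0.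
have := mxdot_ge0 (enorm B ^+ 2 *: A + (- mxdot A B) *: B).
rewrite mxdotDl !mxdotZl ![mxdot _ (_ + _)]mxdotC !mxdotDl !mxdotZl.
rewrite -[mxdot A A]enorm_sqr -[mxdot B B]enorm_sqr [mxdot B A]mxdotC.
move=> AB; apply: le_trans (ler_norm _) _.
rewrite -ler_sqr ?nnegrE ?mulr_ge0 ?enorm_ge0// real_normK ?num_real//.
rewrite -subr_ge0 -(pmulr_rge0 _ B0); apply: le_trans AB _.
by rewrite le_eqVlt; apply/orP; left; apply/eqP; ring.
Qed.

Lemma enormD A B : enorm (A + B) <= enorm A + enorm B.
Proof.
rewrite -ler_sqr ?nnegrE ?addr_ge0 ?enorm_ge0// enorm_sqr.
rewrite mxdotDl ![mxdot _ (_ + _)]mxdotC !mxdotDl [mxdot B A]mxdotC.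
rewrite -[mxdot A A]enorm_sqr -[mxdot B B]enorm_sqr.
by have := mxdot_le A B; nra.
Qed.

End euclidean.

Lemma measurable_enorm (R : realType) d (T : measurableType d) m n
    (u : T -> 'M[R]_(m, n)) :
  measurable_fun [set: T] u -> measurable_fun [set: T] (fun x => enorm (u x)).
Proof.
move=> mu; apply: (measurableT_comp (f := @Num.sqrt R)).
  by apply: continuous_measurable_fun; exact: sqrt_continuous.
apply: measurable_sum => i; apply: measurable_sum => j.
by apply: measurable_funM; exact: (measurableT_comp (measurable_entry i j)).
Qed.

Section Lp_fields.
Context d (T : measurableType d) (R : realType).
Variable mu : {measure set T -> \bar R}.

Definition Lp_norm m n (r : \bar R) (u : T -> 'M[R]_(m, n)) : \bar R :=
  'N[mu]_r[EFin \o (fun x => enorm (u x))]%E.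

Definition Lp_fields m n (r : \bar R) : set (T -> 'M[R]_(m, n)) :=
  [set u | measurable_fun [set: T] u /\ (Lp_norm r u < +oo)%E].

Definition spair (u v : T -> R) : R := \int[mu]_x (u x * v x).

Definition mpair m n (u v : T -> 'M[R]_(m, n)) : R :=
  \int[mu]_x mxdot (u x) (v x).

(** Representatives of [L^2] fields; two of them are the same point of [L^2]
exactly when their [L2dist] is zero.  The pseudometric topology below, hence
its Borel sigma-algebra, its continuous functions and its Lipschitz functions,
are the ones pulled back from the quotient. *)
Record L2field n := MkL2field {
  L2fun :> T -> 'rV[R]_n ;
  L2funP : Lp_fields 2%:E L2fun }.

Definition L2dist n (u v : L2field n) : R :=
  fine (Lp_norm 2%:E (fun x => u x - v x)).

Section L2field_pseudometric.
Variable n : nat.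
Implicit Types u v w : L2field n.

Let L2zero : Lp_fields 2%:E (fun=> 0 : 'rV[R]_n).
Proof.
split; first exact: measurable_cst.
rewrite /Lp_norm (_ : _ \o _ = cst 0%E) ?Lnorm0//.
by apply/funext => x /=; rewrite enorm0.
Qed.

HB.instance Definition _ := gen_eqMixin (L2field n).
HB.instance Definition _ := gen_choiceMixin (L2field n).
HB.instance Definition _ := isPointed.Build (L2field n) (MkL2field L2zero).

Let sub_measurable u v : measurable_fun [set: T] (fun x => u x - v x).
Proof.
apply: measurable_fun_mx => i j; under eq_fun do rewrite !mxE.
by apply: measurable_funB;
  apply: (measurableT_comp (measurable_entry i j)); exact: (L2funP _).1.
Qed.

Let Lp_norm_triangle (a b : T -> 'rV[R]_n) :
  measurable_fun [set: T] a -> measurable_fun [set: T] b ->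
  (Lp_norm 2%:E (fun x => (a x + b x)%R) <= Lp_norm 2%:E a + Lp_norm 2%:E b)%E.
Proof.
move=> ma mb.
have m_a := measurable_enorm ma; have m_b := measurable_enorm mb.
have m_ab : measurable_fun [set: T] (fun x => a x + b x).
  apply: measurable_fun_mx => i j; under eq_fun do rewrite mxE.
  by apply: measurable_funD; exact: (measurableT_comp (measurable_entry i j)).
apply: (@le_trans _ _ _ _ _ _ (minkowski_EFin mu m_a m_b (ler1n R 2))).
rewrite /Lp_norm unlock gt0_ler_poweR ?in_itv/= ?leey ?integral_ge0//.
have mp (h : T -> R) : measurable_fun [set: T] h ->
    measurable_fun [set: T] (fun x => (`|(h x)%:E| `^ 2)%E).
  move=> mh; apply: (measurableT_comp (measurable_poweR _)).
  by apply: measurableT_comp => //; exact/measurable_EFinP.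
apply: ge0_le_integral => //=.
- exact: mp (measurable_enorm m_ab).
- by apply: mp; exact: measurable_funD.
- move=> x _; rewrite lee_fin ge0_ler_powR ?nnegrE//.
  by rewrite !ger0_norm ?addr_ge0 ?enorm_ge0// enormD.
Qed.

Let L2dist_fin u v : (L2dist u v)%:E = Lp_norm 2%:E (fun x => u x - v x).
Proof.
rewrite fineK// ge0_fin_numE ?Lnorm_ge0//.
have [[mu_ fu] [mv fv]] := (L2funP u, L2funP v).
have NvE : Lp_norm 2%:E (fun x => - v x) = Lp_norm 2%:E v.
  by apply: eq_Lnorm => x /=; rewrite enormN.
apply: (@le_lt_trans _ _ _ _ _ (Lp_norm_triangle mu_ _)); last first.
  by rewrite NvE lte_add_pinfty.
apply: measurable_fun_mx => i j; under eq_fun do rewrite mxE.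
by apply: measurableT_comp => //; exact: (measurableT_comp (measurable_entry i j)).
Qed.

Lemma L2distxx u : L2dist u u = 0.
Proof.
rewrite /L2dist (_ : (fun x => _) = (fun=> 0)); last first.
  by apply/funext => x; rewrite subrr.
rewrite /Lp_norm (_ : _ \o _ = cst 0%E) ?Lnorm0//.
by apply/funext => x /=; rewrite enorm0.
Qed.

Lemma L2dist_sym u v : L2dist u v = L2dist v u.
Proof.
by congr fine; apply: eq_Lnorm => x /=; rewrite -enormN opprB.
Qed.

Lemma L2dist_triangle u v w : L2dist u w <= L2dist u v + L2dist v w.
Proof.
rewrite -lee_fin EFinD !L2dist_fin.
rewrite (_ : (fun x => u x - w x) = fun x => (u x - v x) + (v x - w x)).
  by apply: Lp_norm_triangle; exact: sub_measurable.
by apply/funext => x; rewrite addrA subrK.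
Qed.

Let ball u (e : R) : set (L2field n) := [set v | L2dist u v < e].

Let ent : set_system (L2field n * L2field n) := entourage_ ball.

HB.instance Definition _ := hasNbhs.Build (L2field n) (nbhs_ ent).

Let ball_center u (e : R) : 0 < e -> ball u e u.
Proof. by rewrite /ball/= L2distxx. Qed.

Let ball_sym u v (e : R) : ball u e v -> ball v e u.
Proof. by rewrite /ball/= L2dist_sym. Qed.

Let ball_triangle u v w e1 e2 :
  ball u e1 v -> ball v e2 w -> ball u (e1 + e2) w.
Proof. by move=> uv vw; exact: le_lt_trans (L2dist_triangle u v w) (ltrD uv vw). Qed.

HB.instance Definition _ := @Nbhs_isPseudoMetric.Build R (L2field n)
  ent erefl ball ball_center ball_sym ball_triangle erefl.

HB.instance Definition _ :=
  @isMeasurable.Build (sigma_display (@open (L2field n))) (L2field n)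
    <<s @open (L2field n) >> (@sigma_algebra0 _ setT _) (@sigma_algebraC _ _)
    (@sigma_algebra_bigcup _ setT _).

End L2field_pseudometric.
End Lp_fields.

Section domain.
Variables (R : realType) (d : nat).
Local Notation point := 'rV[R]_d.

Definition polytope m (V : 'M[R]_(m, d)) : set point :=
  [set w *m V | w in [set w : 'rV[R]_m |
    (forall i, 0 <= w ord0 i) /\ \sum_i w ord0 i = 1]].

Record polygonal_domain := PolygonalDomain {
  dom :> set point ;
  dom_open : open dom ;
  dom_neq0 : dom !=set0 ;
  dom_connected : connected dom ;
  dom_bounded : bounded_set dom ;
  dom_polygonal : exists (k : nat) (m : 'I_k -> nat)
      (V : forall i, 'M[R]_(m i, d)),
    dom = (\bigcup_i polytope (V i))° }.

Variable O : polygonal_domain.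

(** Lebesgue measure restricted to [O]: functions on [O] are represented by
Borel functions on the whole space, whose values outside [O] are irrelevant. *)
Definition dx : {measure set point -> \bar R} :=
  mrestr (lebesgue_rV R d) (open_measurable_mx (@dom_open O)).

(** [pderiv s f] is the iterated partial derivative of [f] along the list [s]
of coordinates. *)
Definition pderiv (s : seq 'I_d) (f : point -> R) : point -> R :=
  foldr (fun i h => 'D_(delta_mx ord0 i) h) f s.

Definition smooth_on (A : set point) (f : point -> R) :=
  forall s i x, A x -> derivable (pderiv s f) x (delta_mx ord0 i) /\
    {for x, continuous (pderiv s f)}.

Definition test_function (phi : point -> R) :=
  smooth_on setT phi /\ exists K : set point,
    [/\ compact K, K `<=` O & forall x, ~ K x -> phi x = 0].

Definition is_weak_deriv (s : seq 'I_d) (u w : point -> R) :=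
  forall phi, test_function phi ->
    spair dx u (pderiv s phi) = (-1) ^+ size s * spair dx w phi.

Definition Sobolev (k : nat) (r : \bar R) (u : point -> R) :=
  u \in Lfun dx r /\ forall s, (size s <= k)%N ->
    exists w, w \in Lfun dx r /\ is_weak_deriv s u w.

(** The weak derivative of [u] in [L^r]; the default value is used only when
there is none. *)
Definition weak_deriv (r : \bar R) (s : seq 'I_d) (u : point -> R) :
    point -> R :=
  xget (cst 0) [set w | w \in Lfun dx r /\ is_weak_deriv s u w].

Definition component (u : point -> 'rV[R]_d) (i : 'I_d) : point -> R :=
  fun x => u x ord0 i.

Definition Sobolev_field k r (u : point -> 'rV[R]_d) :=
  forall i, Sobolev k r (component u i).

(** Entry [(j, i)] is the [j]-th partial derivative of the [i]-th component. *)
Definition weak_grad r (u : point -> 'rV[R]_d) : point -> 'M[R]_d :=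
  fun x => \matrix_(j, i) weak_deriv r [:: j] (component u i) x.

Definition sym_grad r (u : point -> 'rV[R]_d) : point -> 'M[R]_d :=
  fun x => 2^-1 *: (weak_grad r u x + (weak_grad r u x)^T).

Definition W1_norm (r : R) (z : point -> 'rV[R]_d) : \bar R :=
  ((Lp_norm dx r%:E z `^ r + Lp_norm dx r%:E (weak_grad r%:E z) `^ r)
     `^ r^-1)%E.

Definition Winfty_norm (k : nat) (u : point -> 'rV[R]_d) : \bar R :=
  ereal_sup [set 'N[dx]_+oo[EFin \o weak_deriv +oo s (component u i)]%E |
    s in [set s | (size s <= k)%N] & i in [set: 'I_d]].

Definition divergence (u : point -> 'rV[R]_d) : point -> R :=
  fun x => \sum_i pderiv [:: i] (component u i) x.

(** The closure in [W^{k,oo}(O)] of the divergence-free fields that are smooth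
in [O]. *)
Definition Winfty_div (k : nat) (u : point -> 'rV[R]_d) :=
  Sobolev_field k +oo u /\ forall e : R, 0 < e ->
    exists phi, [/\ forall i, smooth_on O (component phi i),
      forall x, dom O x -> divergence phi x = 0,
      Sobolev_field k +oo phi &
      (Winfty_norm k (fun x => u x - phi x)%R < e%:E)%E].

End domain.

Section gradient_discretisation.
Variables (R : realType) (d : nat) (O : polygonal_domain R d).
Local Notation point := 'rV[R]_d.

Definition dual_exp (p : R) := p / (p - 1).

Definition is_norm_on (V : lmodType R) (A : set V) (N : V -> \bar R) :=
  [/\ forall v, A v -> (0 <= N v < +oo)%E,
      forall v, A v -> N v = 0%E -> v = 0,
      forall a v, A v -> N (a *: v) = (`|a|%:E * N v)%E &
      forall v w, A v -> A w -> (N (v + w)%R <= N v + N w)%E].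

(** The discrete operators are linear maps into spaces of representatives; on
a finite-dimensional space every linear map into [L^r] lifts to such a map. *)
Record gradDisc (p : R) := GradDisc {
  gdX : vectType R ;
  gdY : vectType R ;
  gdgrad : {linear gdX -> (point -> 'M[R]_d)} ;
  gdeps : {linear gdX -> (point -> 'M[R]_d)} ;
  gddiv : {linear gdX -> (point -> R)} ;
  gdPi : {linear gdX -> (point -> 'rV[R]_d)} ;
  gdchi : {linear gdY -> (point -> R)} ;
  gdY0 : set gdY := [set q | \int[dx O]_x gdchi q x = 0] ;
  gdE0 : set gdX :=
    [set v | forall q, gdY0 q -> spair (dx O) (gdchi q) (gddiv v) = 0] ;
  gdgradP : forall r v, r \in [:: p; dual_exp p] ->
    Lp_fields (dx O) r%:E (gdgrad v) ;
  gdepsP : forall r v, r \in [:: p; dual_exp p] ->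
    Lp_fields (dx O) r%:E (gdeps v) ;
  gddivP : forall r v, r \in [:: p; dual_exp p] -> gddiv v \in Lfun (dx O) r%:E ;
  gdPiP : forall r v, r \in [:: 2; p; dual_exp p] ->
    Lp_fields (dx O) r%:E (gdPi v) ;
  gdchiP : forall q, gdchi q \in Lfun (dx O) (Num.min p (dual_exp p))%:E ;
  gdeps_norm : is_norm_on setT (fun v => Lp_norm (dx O) p%:E (gdeps v)) ;
  gdchi_norm : is_norm_on gdY0
    (fun q => 'N[dx O]_((Num.min p (dual_exp p))%:E)[EFin \o gdchi q]%E) ;
  gdPi_inj : forall v w, gdE0 v -> gdE0 w ->
    {ae dx O, forall x, gdPi v x = gdPi w x} -> v = w }.

End gradient_discretisation.

Section gamma_stable.
Variables (R : realType) (d : nat) (O : polygonal_domain R d) (p : R).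
Variable D : gradDisc O p.
Local Notation point := 'rV[R]_d.
Local Open Scope ereal_scope.

Definition gdC (r : R) : \bar R :=
  ereal_sup [set (Lp_norm (dx O) r%:E (gdPi D v) +
                  'N[dx O]_(r%:E)[EFin \o gddiv D v] +
                  Lp_norm (dx O) r%:E (gdgrad D v)) /
                 Lp_norm (dx O) r%:E (gdeps D v) |
            v in [set v : gdX D | v != 0%R]].

(** The [L^2]-projection onto the discretely divergence-free functions.  It is
applied to every field whose pairings with the [gdPi D xi] make sense, i.e. to
fields in [L^2], [L^p] or [L^p']. *)
Definition gdK (u : point -> 'rV[R]_d) : gdX D :=
  xget 0%R [set w | gdE0 w /\ forall xi, gdE0 xi ->
    mpair (dx O) (fun x => u x - gdPi D w x)%R (gdPi D xi) = 0%R].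

Definition gdCSob (r : R) : \bar R :=
  ereal_sup [set Lp_norm (dx O) r%:E (gdeps D (gdK z)) / W1_norm O r z |
            z in [set z | Sobolev_field O 1 r%:E z /\ W1_norm O r z != 0]].

Definition gdbeta : \bar R :=
  ereal_inf [set ereal_sup
    [set (spair (dx O) (gdchi D q) (gddiv D v))%:E /
         ('N[dx O]_((Num.min p (dual_exp p))%:E)[EFin \o gdchi D q] *
          (Lp_norm (dx O) p%:E (gdeps D v) +
           Lp_norm (dx O) (dual_exp p)%:E (gdeps D v))) |
     v in [set v : gdX D | v != 0%R]] |
    q in [set q : gdY D | gdY0 q /\ q != 0%R]].

Definition gamma_stable (Gamma : R) :=
  [/\ (1 <= Gamma)%R,
      gdC p + gdC (dual_exp p) <= Gamma%:E,
      (Gamma^-1)%:E <= gdbeta &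
      gdCSob p + gdCSob (dual_exp p) <= Gamma%:E].

End gamma_stable.

Section stochastic_basis.
Variables (R : realType) (dOm : measure_display) (Omega : measurableType dOm).
Variable P : probability Omega R.

(** Filtrations are indexed by [R]; only nonnegative times matter. *)
Definition usual_filtration (F : R -> set (set Omega)) :=
  [/\ forall t, 0 <= t -> sigma_algebra setT (F t) /\ F t `<=` measurable,
      forall s t, 0 <= s -> s <= t -> F s `<=` F t,
      P.-negligible `<=` F 0 &
      forall t, 0 <= t -> \bigcap_(s in [set s | t < s]) F s `<=` F t].

Definition increment (W : R -> Omega -> R) (s t : R) : Omega -> R :=
  fun w => W t w - W s w.

Definition Wiener_process (F : R -> set (set Omega)) (W : R -> Omega -> R) :=
  [/\ forall t B, 0 <= t -> measurable B -> F t (W t @^-1` B),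
      {ae P, forall w, W 0 w = 0},
      {ae P, forall w, {within `[0, +oo[%classic, continuous (W ^~ w)}},
      forall s t A B, 0 <= s -> s < t -> F s A -> measurable B ->
        P (A `&` increment W s t @^-1` B) =
        (P A * P (increment W s t @^-1` B))%E &
      forall s t B, 0 <= s -> s < t -> measurable B ->
        P (increment W s t @^-1` B) =
        normal_prob 0 (Num.sqrt (t - s)) B].

End stochastic_basis.

Section algorithm.
Variables (R : realType) (d : nat) (O : polygonal_domain R d) (p : R).
Variables (kappa tau : R) (g sigma : 'rV[R]_d -> 'rV[R]_d) (D : gradDisc O p).
Local Notation point := 'rV[R]_d.
Local Notation L2 := (L2field (dx O) d).

(** For [A = 0] this is [0] whatever the value of the power. *)
Definition Sp (A : 'M[R]_d) : 'M[R]_d :=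
  (kappa + enorm A ^+ 2) `^ ((p - 2) / 2) *: A.

Definition Bsigma (v xi : gdX D) : R :=
  2^-1 * mpair (dx O) (fun x => sigma x *m gdgrad D v x) (gdPi D xi) -
  2^-1 * mpair (dx O) (gdPi D v) (fun x => sigma x *m gdgrad D xi x).

Definition gd_initial (vin : L2) (v : gdX D) (pi : gdY D) :=
  [/\ gdY0 pi,
      forall xi, mpair (dx O) (gdPi D v) (gdPi D xi) +
                 spair (dx O) (gdchi D pi) (gddiv D xi) =
                 mpair (dx O) vin (gdPi D xi) &
      forall q, gdY0 q -> spair (dx O) (gddiv D v) (gdchi D q) = 0].

Definition midpoint (v v' : gdX D) : gdX D := 2^-1 *: (v' + v).

Definition gd_step (dWn : R) (v : gdX D) (pi : gdY D) (v' : gdX D)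
    (pi' : gdY D) :=
  forall xi q, gdY0 q ->
    mpair (dx O) (fun x => gdPi D v' x - gdPi D v x) (gdPi D xi) +
    tau * mpair (dx O)
      (fun x => Sp (gdeps D (midpoint v v') x + sym_grad O +oo g x))
      (gdeps D xi) -
    spair (dx O) (fun x => gdchi D pi' x - gdchi D pi x) (gddiv D xi) =
    (Bsigma (midpoint v v') xi +
     mpair (dx O) (fun x => sigma x *m weak_grad O +oo g x) (gdPi D xi)) * dWn
    /\ spair (dx O) (gddiv D (midpoint v v')) (gdchi D q) = 0.

Section solution.
Variables (dOm : measure_display) (Omega : measurableType dOm).
Variables (P : probability Omega R) (W : R -> Omega -> R).

Definition gd_solution (vin : L2) (v : nat -> Omega -> gdX D)
    (pi : nat -> Omega -> gdY D) :=
  (forall w, gd_initial vin (v 0%N w) (pi 0%N w)) /\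
  forall n, (forall w, gdY0 (pi n.+1 w)) /\
    {ae P, forall w, gd_step (increment W (n%:R * tau) (n.+1%:R * tau) w)
      (v n w) (pi n w) (v n.+1 w) (pi n.+1 w)}.

(** Measurability of the iterates is not part of the definition: a solution is
almost surely unique, and the probability space is complete. *)
Definition solution_operator (S : nat -> L2 -> Omega -> gdX D) :=
  forall vin, exists pi, gd_solution vin (S ^~ vin) pi.

Definition half_step (S : nat -> L2 -> Omega -> gdX D) (n : nat) (vin : L2)
    (w : Omega) : gdX D :=
  midpoint (S n vin w) (S n.+1 vin w).

Definition PiL2 (v : gdX D) : L2 :=
  MkL2field (gdPiP v (mem_head 2 [:: p; dual_exp p])).

Definition gd_semigroup (S : nat -> L2 -> Omega -> gdX D) (n : nat)
    (f : L2 -> R) (vin : L2) : R :=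
  fine 'E_P[fun w => f (PiL2 (S n vin w))]%E.

Definition mu_half (S : nat -> L2 -> Omega -> gdX D) (N : nat) (vin : L2)
    (A : set L2) : \bar R :=
  ((N%:R^-1)%:E *
   \sum_(0 <= n < N) P [set w | A (PiL2 (half_step S n vin w))])%E.

End solution.
End algorithm.

(* Main.v *)
Require Import Defs.
From mathcomp Require Import all_boot all_order all_algebra.
From mathcomp Require Import all_classical all_reals all_analysis.
From mathcomp Require Import measurable_realfun ess_sup_inf ring lra.

(** The velocities of the scheme form a Markov chain that does not expand
distances, and the estimate is a telescoping argument for such a chain.

Tested against discretely divergence-free fields the time step loses its
pressure.  Take two solutions of the resulting equation for the same increment
of the Wiener process, write [V] and [V'] for the differences of their old and
new velocities, and test the difference of the two equations with the
difference [(V + V') / 2] of the midpoints.  The flux is monotone and the noise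
form is skew, so the squared [L^2] norm of [V'] is at most that of [V].  As the
initialisation is an orthogonal projection, the semigroup maps a function [f]
with bound [M] and Lipschitz constant [L] to a function with the same two
constants.

Denote by [v_l] the iterates and by [d_l] the distance from the midpoint to
[v_l].  Replacing midpoints by iterates in both integrals costs [L] times the
mean of [E d_l] each.  By the Markov property the semigroup applied [n] times
and evaluated at [v_l] has expectation [E f(v_(l+n))], so the remaining
difference telescopes to [2 n] terms, each bounded by [M / N].  The mean of the
[d_l] is at most their root mean square, which gives the constant
[2 M + 2 L + 1]; the [1] keeps it positive, so that the bound is also valid
when the root mean square is infinite ([midpoint_defect]).

The Markov property needs a measurable transition map, whereas solutions are
given only along almost every trajectory.  Applied to two different increments,
the energy estimate above shows that the step is Lipschitz in the increment
with a constant that depends on one of the two solutions only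
([coord_step_stable]).  Hence, for every bounded Lipschitz [h], McShane's
formula extends the value of [h] after the step from the graph of the step to a
lower semicontinuous function of state and increment ([mcshane]).  This gives
at once that the iterates are adapted ([chain_adapted]; the filtration is
complete) and, through independence and Fubini's theorem, the Markov property
([markov_property]).  To have Borel sets and product measures at hand, the
chain is read in coordinates with respect to an [L^2]-orthonormal basis of the
discretely divergence-free fields ([orthonormal_basis]). *)

Set Implicit Arguments.
Unset Strict Implicit.
Unset Printing Implicit Defensive.
Import Order.TTheory GRing.Theory Num.Theory.
Import numFieldNormedType.Exports.

Local Open Scope classical_set_scope.
Local Open Scope ring_scope.

(** * McShane extension of a Lipschitz step *)

Section measurable_matrix.
Context d (T : measurableType d) (R : realType) (m n : nat).
Implicit Types u v : T -> 'M[R]_(m, n).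

Lemma measurable_mxD u v : measurable_fun setT u -> measurable_fun setT v ->
  measurable_fun setT (fun x => u x + v x).
Proof.
move=> mu mv; apply: measurable_fun_mx => i j; under eq_fun do rewrite mxE.
by apply: measurable_funD; exact: (measurableT_comp (measurable_entry i j)).
Qed.

Lemma measurable_mxZ (a : R) u : measurable_fun setT u ->
  measurable_fun setT (fun x => a *: u x).
Proof.
move=> mu; apply: measurable_fun_mx => i j; under eq_fun do rewrite mxE.
by apply: measurable_funM => //; exact: (measurableT_comp (measurable_entry i j)).
Qed.

Lemma measurable_mxB u v : measurable_fun setT u -> measurable_fun setT v ->
  measurable_fun setT (fun x => u x - v x).
Proof.
move=> mu mv; under eq_fun do rewrite -scaleN1r.
by apply: measurable_mxD => //; exact: measurable_mxZ.
Qed.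

End measurable_matrix.

Lemma continuous_enorm (R : realType) (T : topologicalType) m n
    (u : T -> 'M[R]_(m, n)) :
  (forall i j, continuous (fun x => u x i j)) ->
  continuous (fun x => enorm (u x)).
Proof.
move=> Cu x; apply: (@continuous_comp _ _ _ (fun x => mxdot (u x) (u x))
  (@Num.sqrt R)); last exact: sqrt_continuous.
rewrite /mxdot; apply: continuous_big => //; first exact: add_continuous.
move=> i _; apply: continuous_big => //; first exact: add_continuous.
by move=> j _ z; apply: cvgM; exact: Cu.
Qed.

Lemma continuous_enormB (R : realType) (T : topologicalType) n
    (u : T -> 'rV[R]_n) (v : 'rV[R]_n) :
  (forall j, continuous (fun x => u x ord0 j)) ->
  continuous (fun x => enorm (v - u x)).
Proof.
move=> Cu; apply: (@continuous_enorm _ _ _ _ (fun x => v - u x)) => i j y.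
under eq_fun do rewrite !mxE.
by rewrite (ord1 i); apply: cvgB; [exact: cvg_cst|exact: Cu].
Qed.

Lemma continuous_penalty (R : realType) (T : topologicalType) n
    (u : T -> 'rV[R]_n) (s : T -> R) (v : 'rV[R]_n) (w c L b : R) :
  (forall j, continuous (fun x => u x ord0 j)) -> continuous s ->
  continuous (fun x => c - L * (enorm (v - u x) + b * `|w - s x|)).
Proof.
move=> Cu Cs x; apply: cvgB; first exact: cvg_cst.
apply: cvgM; first exact: cvg_cst.
apply: cvgD; first exact: continuous_enormB.
apply: cvgM; first exact: cvg_cst.
by apply: cvg_norm; apply: cvgB; [exact: cvg_cst|exact: Cs].
Qed.

(** The topology of row vectors is that of the sup norm; this is the passage to
the Euclidean norm. *)
Lemma open_enorm (R : realType) n (U : set 'rV[R]_n) :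
  (forall v, U v -> exists2 r, 0 < r & forall u, enorm (v - u) < r -> U u) ->
  open U.
Proof.
move=> Uball; have -> : U = \bigcup_(vr in [set vr : 'rV[R]_n * R |
    forall u, enorm (vr.1 - u) < vr.2 -> U u])
    [set u | enorm (vr.1 - u) < vr.2].
  apply/seteqP; split => [v /[dup] Uv /Uball[r r0 rU]|u [vr vrU]]; last exact: vrU.
  by exists (v, r) => //=; rewrite subrr enorm0.
apply: bigcup_open => vr _; apply: (@open_comp _ _ _ [set r | r < vr.2]).
  by move=> u _; apply: (continuous_enormB (u := id)) => j; exact: coord_continuous.
exact: open_lt.
Qed.

Section mcshane.
Variables (R : realType) (k : nat).
Local Notation H := 'rV[R]_k.
Variables (G : H -> R -> H -> Prop) (K : H -> H -> R) (h : H -> R) (M L : R).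

(** The smallest function with values at least [-M] that respects the lower bounds
obtained from the stability of the step at every point of the graph of [G].  It
is a supremum of continuous functions, and it makes sense even where the step
has no solution. *)
Definition mcshane (y : R * H) : R :=
  sup (-M |` [set a | exists v w v', G v w v' /\
    a = h v' - L * (enorm (v - y.2) + K v v' * `|w - y.1|)]).

Hypothesis K_ge0 : forall v v', 0 <= K v v'.
Hypothesis GP : forall v1 w1 v1' v2 w2 v2', G v1 w1 v1' -> G v2 w2 v2' ->
  enorm (v2' - v1') <= enorm (v2 - v1) + K v2 v2' * `|w2 - w1|.
Hypothesis L_ge0 : 0 <= L.
Hypothesis hM : forall x, `|h x| <= M.
Hypothesis hL : forall x y, `|h x - h y| <= L * enorm (x - y).

Let family y := -M |` [set a | exists v w v', G v w v' /\
    a = h v' - L * (enorm (v - y.2) + K v v' * `|w - y.1|)].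

Let family_ub y : ubound (family y) M.
Proof.
move=> _ [->|[v [w [v' [_ ->]]]]].
  by have := le_trans (normr_ge0 _) (hM 0); lra.
have := hM v'; rewrite ler_norml => /andP[_ hv].
rewrite lerBlDr (le_trans hv)// lerDl mulr_ge0// addr_ge0 ?enorm_ge0//.
by rewrite mulr_ge0.
Qed.

Let has_ub y : has_ubound (family y). Proof. by exists M; exact: family_ub. Qed.

Lemma mcshane_bounded y : `|mcshane y| <= M.
Proof.
rewrite ler_norml; apply/andP; split.
  by apply: (ub_le_sup (has_ub y)); left.
by apply: ge_sup; [exists (-M); left|exact: family_ub].
Qed.

(** The stability estimate has the gain [K] of the second solution, which is the
one over which the supremum is taken; so no competitor exceeds [h v']. *)
Lemma mcshaneE v w v' : G v w v' -> mcshane (w, v) = h v'.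
Proof.
move=> Gv; apply/eqP; rewrite eq_le; apply/andP; split.
  apply: ge_sup; first by exists (-M); left.
  move=> _ [->|[v2 [w2 [v2' [Gv2 ->]]]]] /=.
    by have := hM v'; rewrite ler_norml => /andP[].
  have := hL v2' v'; rewrite ler_norml => /andP[_ h2].
  have := ler_wpM2l L_ge0 (GP Gv Gv2); lra.
apply: (ub_le_sup (has_ub (w, v))); right; exists v, w, v'; split => //=.
by rewrite !subrr enorm0 normr0 mulr0 addr0 mulr0 subr0.
Qed.

Let tl (x : 'rV[R]_k.+1) : H := \row_j x ord0 (lift ord0 j).

(** A supremum of continuous functions is lower semicontinuous, whatever the size
of the family. *)
Lemma measurable_mcshane : measurable_fun setT mcshane.
Proof.
apply: (measurability _ (RGenOInfty.measurableE R)) => _ [_ [a ->] <-].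
rewrite setTI.
have [aM|Ma] := ltP a (- M).
  rewrite [X in measurable X](_ : _ = setT)//; apply/seteqP; split => // y _.
  rewrite /= in_itv/= andbT (lt_le_trans aM)//.
  by have := mcshane_bounded y; rewrite ler_norml => /andP[].
pose U := \bigcup_(g in [set g | G g.1.1 g.1.2 g.2])
  [set x | a < h g.2 - L * (enorm (g.1.1 - tl x) +
      K g.1.1 g.2 * `|g.1.2 - x ord0 ord0|)].
have -> : mcshane @^-1` `]a, +oo[ = @row_cons R k @^-1` U.
  have tlE y : tl (row_cons y) = y.2.
    by apply/rowP => j; rewrite !mxE liftK.
  have hdE y : row_cons y ord0 ord0 = y.1 by rewrite mxE unlift_none.
  apply/seteqP; split => y /=.
    rewrite in_itv/= andbT => /sup_gt[|_ [->|[v [w [v' [Gv ->]]]]] av].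
    - by exists (-M); left.
    - by move: av; rewrite ltNge Ma.
    - by exists (v, w, v') => //=; rewrite tlE hdE.
  move=> [[[v w] v'] /= Gv]; rewrite tlE hdE in_itv/= andbT => av.
  apply: (lt_le_trans av); apply: (ub_le_sup (has_ub y)); right.
  by exists v, w, v'.
rewrite -[X in measurable X]setTI; apply: measurable_row_cons => //.
apply: open_measurable_mx; apply: bigcup_open => g _.
apply: (@open_comp _ _ _ [set r | a < r]); last exact: open_gt.
move=> x _; apply: continuous_penalty => [j|]; last exact: coord_continuous.
under eq_fun do rewrite mxE.
exact: coord_continuous.
Qed.

End mcshane.

(** * Markov chains driven by independent noise *)

Section bounded_expectation.
Context d (T : measurableType d) (R : realType) (Q : probability T R).
Implicit Types f g : T -> R.

Lemma bounded_integrable f M : measurable_fun [set: T] f ->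
  (forall x, `|f x| <= M) -> Q.-integrable setT (EFin \o f).
Proof.
move=> mf fM; apply: (le_integrable measurableT _ _
    (finite_measure_integrable_cst Q M measurableT)) => [|x _].
  exact/measurable_EFinP.
by rewrite /= lee_fin (le_trans (fM x))// ler_norm.
Qed.

Lemma Rintegral_prob_cst (c : R) : \int[Q]_x c = c.
Proof. by rewrite Rintegral_cst//= probability_setT mulr1. Qed.

Lemma ae_Rintegral_le f c : measurable_fun [set: T] f -> 0 <= c ->
  {ae Q, forall x, `|f x| <= c} -> `|\int[Q]_x f x| <= c.
Proof.
move=> mf c0 fc.
have mnf : measurable_fun [set: T] (fun x => `|f x|%:E).
  by apply/measurable_EFinP; exact: measurableT_comp.
have fle : (\int[Q]_x `|f x|%:E <= c%:E)%E.
  rewrite -[leRHS]mule1 -(@probability_setT _ _ _ Q) -integral_cst//.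
  apply: ae_ge0_le_integral => //.
  by apply: filterS fc => x fx _; rewrite lee_fin.
have fI : Q.-integrable setT (EFin \o f).
  apply/integrableP; split; first exact/measurable_EFinP.
  by rewrite (le_lt_trans fle)// ltry.
rewrite -lee_fin EFin_normr_Rintegral//.
apply: le_trans fle.
by apply: (le_abse_integral Q measurableT); exact/measurable_EFinP.
Qed.

Lemma ae_Rintegral_close f g M c : measurable_fun [set: T] f ->
  measurable_fun [set: T] g -> (forall x, `|f x| <= M) ->
  (forall x, `|g x| <= M) -> 0 <= c ->
  {ae Q, forall x, `|f x - g x| <= c} ->
  `|\int[Q]_x f x - \int[Q]_x g x| <= c.
Proof.
move=> mf mg fM gM c0 fg; rewrite -RintegralB//; last 2 first.
  exact: bounded_integrable fM.
  exact: bounded_integrable gM.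
by apply: ae_Rintegral_le => //; exact: measurable_funB.
Qed.

Lemma ae_eq_Rintegral f g : measurable_fun [set: T] f ->
  measurable_fun [set: T] g -> {ae Q, forall x, f x = g x} ->
  \int[Q]_x f x = \int[Q]_x g x.
Proof.
move=> mf mg fg; congr fine; apply: ae_eq_integral => //.
- exact/measurable_EFinP.
- exact/measurable_EFinP.
- by apply: filterS fg => x -> _.
Qed.

End bounded_expectation.

Section independence.
Context d1 d2 (T1 : measurableType d1) (T2 : measurableType d2).
Context dOm (Omega : measurableType dOm) (R : realType).
Variables (P : probability Omega R) (nu : probability T1 R).
Variables (xi : Omega -> T1) (x : Omega -> T2) (F : T1 * T2 -> R) (M : R).

(** Independence says that the joint law is a product measure, to which Fubini's
theorem applies. *)
Lemma independent_Rintegral : measurable_fun setT xi -> measurable_fun setT x ->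
  (forall A B, measurable A -> measurable B ->
     P (x @^-1` A `&` xi @^-1` B) = (P (x @^-1` A) * nu B)%E) ->
  measurable_fun setT F -> (forall y, `|F y| <= M) ->
  \int[P]_w F (xi w, x w) = \int[P]_w \int[nu]_s F (s, x w).
Proof.
move=> mxi mx ind mF FM.
pose pack d (T : measurableType d) (f : Omega -> T)
    (mf : measurable_fun setT f) : {RV P >-> T} :=
  MeasurableFun.Pack (MeasurableFun.Class (isMeasurableFun.Build _ _ _ _ _ mf)).
have mZ : measurable_fun setT (fun w => (xi w, x w)).
  exact: measurable_fun_pair.
pose X := pack _ _ _ mx; pose Z := pack _ _ _ mZ.
have Fint d (T : measurableType d) (Q : probability T R) (g : T -> T1 * T2) :
    measurable_fun setT g -> Q.-integrable setT (EFin \o (F \o g)).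
  move=> mg; apply: (@bounded_integrable _ _ _ _ _ M) => // [|t]; last exact: FM.
  exact: measurableT_comp.
congr fine.
transitivity (\int[distribution P Z]_z (F z)%:E)%E.
  rewrite integral_distribution//; first exact/measurable_EFinP.
  exact: (Fint _ _ P _ mZ).
transitivity (\int[(nu \x distribution P X)%E]_z (F z)%:E)%E.
  apply: eq_measure_integral => A mA _; apply/esym.
  apply: product_measure_unique => // B C mB mC.
  by rewrite [RHS]muleC [RHS](esym (ind C B mC mB)) setIC.
have Fprod : (nu \x distribution P X)%E.-integrable setT (EFin \o F).
  exact: (Fint _ _ (nu \x distribution P X)%E id).
have M0 : 0 <= M := le_trans (normr_ge0 _) (FM point).
pose g y := \int[nu]_s F (s, y).
have mFy y : measurable_fun setT (fun s => F (s, y)) by exact: measurable_fun_pair1.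
have GE : fubini_G nu (EFin \o F) = EFin \o g.
  apply/funext => y; rewrite /fubini_G /= fineK//.
  exact: integrable_fin_num (bounded_integrable nu (mFy y) (fun s => FM (s, y))).
have gM y : `|g y| <= M 
  by apply: (ae_Rintegral_le (mFy y) M0); apply: aeW => s; exact: FM.
have mg : measurable_fun setT g.
  by apply/measurable_EFinP; rewrite -GE; exact: (measurable_fubini_G Fprod).
rewrite -integral21_prod_meas1// GE integral_distribution//.
  exact/measurable_EFinP.
apply: (@bounded_integrable _ _ _ P (g \o x) M) => //; last by move=> w; exact: gM.
exact: measurableT_comp.
Qed.

End independence.

Section adapted.
Context dOm (Omega : measurableType dOm) (R : realType).
Variable P : probability Omega R.

Definition adapted (F : set (set Omega)) d (T : measurableType d)
    (X : Omega -> T) :=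
  forall B, measurable B -> F (X @^-1` B).

Definition complete_subalgebra (F : set (set Omega)) :=
  [/\ sigma_algebra setT F, F `<=` measurable & P.-negligible `<=` F].

Variable F : set (set Omega).
Hypothesis hF : complete_subalgebra F.

Local Notation OmegaF := (g_sigma_algebraType F).

Lemma measurable_subalgebraE (A : set Omega) : F A = measurable (A : set OmegaF).
Proof. by case: hF => sF _ _; rewrite measurable_g_measurableTypeE. Qed.

Lemma adaptedP d (T : measurableType d) (X : Omega -> T) :
  adapted F X <-> measurable_fun [set: OmegaF] (X : OmegaF -> T).
Proof.
split=> [aX _ B mB|mX B mB]; first by rewrite setTI -measurable_subalgebraE; exact: aX.
by rewrite measurable_subalgebraE -[X in measurable X]setTI; exact: mX.
Qed.

Lemma adapted_measurable d (T : measurableType d) (X : Omega -> T) :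
  adapted F X -> measurable_fun [set: Omega] X.
Proof.
by case: hF => _ FO _ aX _ B mB; rewrite setTI; apply: FO; exact: aX.
Qed.

(** The exceptional set and all its subsets belong to [F]. *)
Lemma adapted_ae d (T : measurableType d) (X Y : Omega -> T) :
  {ae P, forall w, X w = Y w} -> adapted F X -> adapted F Y.
Proof.
move=> XY aX B mB; have [_ _ negF] := hF.
pose N := ~` [set w | X w = Y w].
have FN A : A `<=` N -> measurable (A : set OmegaF).
  by move=> AN; rewrite -measurable_subalgebraE; apply: negF; exact: negligibleS XY.
rewrite (_ : Y @^-1` B = (X @^-1` B `\` N) `|` (Y @^-1` B `&` N)).
  rewrite measurable_subalgebraE; apply: measurableU; last by apply: FN => w [].
  by apply: measurableD; [rewrite -measurable_subalgebraE; exact: aX|exact: FN].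
apply/seteqP; split=> w /=.
  have [XYw BY|XYw BY] := pselect (X w = Y w); last by right.
  by left; split; [rewrite /preimage/= XYw|apply].
by move=> [[BX /contrapT <-]|[]].
Qed.

End adapted.

Section markov.
Context dOm (Omega : measurableType dOm) (R : realType).
Variables (P : probability Omega R) (nu : probability R R).
Variables (filt : nat -> set (set Omega)) (xi : nat -> Omega -> R).

Definition fresh_noise := [/\
  forall n, complete_subalgebra P (filt n),
  forall n, filt n `<=` filt n.+1,
  forall n, adapted (filt n.+1) (xi n) &
  forall n A B, filt n A -> measurable B ->
    P (A `&` xi n @^-1` B) = (P A * nu B)%E].

Hypothesis noise : fresh_noise.

Variable k : nat.
Local Notation H := 'rV[R]_k.
Variables (G : H -> R -> H -> Prop) (K : H -> H -> R).

Definition chain (x0 : H) (x : nat -> Omega -> H) :=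
  (forall w, x 0%N w = x0) /\
  forall n, {ae P, forall w, G (x n w) (xi n w) (x n.+1 w)}.

Hypothesis K_ge0 : forall v v', 0 <= K v v'.
Hypothesis GP : forall v1 w1 v1' v2 w2 v2', G v1 w1 v1' -> G v2 w2 v2' ->
  enorm (v2' - v1') <= enorm (v2 - v1) + K v2 v2' * `|w2 - w1|.

(** Both constants are fixed because the semigroup preserves each of them. *)
Definition BLip (M L : R) (h : H -> R) :=
  [/\ 0 <= L, forall x, `|h x| <= M &
      forall x y, `|h x - h y| <= L * enorm (x - y)].

Lemma chain_mcshane M L h x0 x n : BLip M L h -> chain x0 x ->
  {ae P, forall w, mcshane G K h M L (xi n w, x n w) = h (x n.+1 w)}.
Proof.
move=> [L0 hM hL] [_ /(_ n)]; apply: filterS => w Gw.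
exact: (mcshaneE K_ge0 GP L0 hM hL Gw).
Qed.

(** Positivity of these functions detects whether a coordinate exceeds [a], so they
suffice to prove measurability. *)
Lemma BLip_clamp (j : 'I_k) (a : R) :
  BLip 1 1 (fun x : H => Num.min 1 (Num.max 0 (x ord0 j - a))).
Proof.
split=> // [x|x y].
  by rewrite ger0_norm ?ge_min ?lexx// le_min ler01 le_max lexx.
have : `|x ord0 j - y ord0 j| <= enorm (x - y).
  rewrite -sqrtr_sqr ler_wsqrtr// /mxdot big_ord1 (bigD1 j)//= !mxE -expr2.
  by rewrite lerDl sumr_ge0// => i _; rewrite -expr2 sqr_ge0.
rewrite mul1r; apply: le_trans.
have clampE (s : R) : Num.min 1 (Num.max 0 s) =
    if s <= 0 then 0 else if s <= 1 then s else 1.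
  case: (leP s 0) => s0; first by rewrite min_r.
  by case: (leP s 1).
rewrite !clampE ler_norml.
have N1 := ler_norm (x ord0 j - y ord0 j).
have := ler_norm (y ord0 j - x ord0 j); rewrite distrC => N2.
case: (leP (x ord0 j - a) 0) => ?; case: (leP (y ord0 j - a) 0) => ?;
  case: (leP (x ord0 j - a) 1) => ?; case: (leP (y ord0 j - a) 1) => ?;
  by apply/andP; split; lra.
Qed.

(** The next state, seen through bounded Lipschitz functions, is almost surely a
Borel function of the current state and the noise. *)
Lemma chain_adapted x0 x n : chain x0 x -> adapted (filt n) (x n).
Proof.
have [cF Fle axi _] := noise.
move=> cx; elim: n => [|n IHn].
  apply/(adaptedP (cF 0%N)); rewrite (_ : x 0%N = cst x0).
    exact: measurable_cst.
  by apply/funext => w; rewrite cx.1.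
have hx h : BLip 1 1 h -> adapted (filt n.+1) (h \o x n.+1).
  move=> [L0 hM hL].
  apply: (adapted_ae (cF n.+1) (chain_mcshane n (And3 L0 hM hL) cx)).
  have mxi := (adaptedP (cF n.+1) _).1 (axi n).
  have mx : adapted (filt n.+1) (x n) by move=> B mB; apply: Fle; exact: IHn.
  move/(adaptedP (cF n.+1)) : mx => mx.
  apply/(adaptedP (cF n.+1)).
  apply: (@measurableT_comp _ _ _ (g_sigma_algebraType (filt n.+1)) (R * H)%type
    R (mcshane G K h 1 1) _ (fun w => (xi n w, x n w))).
    exact: measurable_mcshane.
  exact: measurable_fun_pair.
apply/(adaptedP (cF n.+1)); apply: measurable_fun_mx => i j.
apply: (measurability _ (RGenOInfty.measurableE R)) => _ [_ [a ->] <-].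
have := hx _ (BLip_clamp j a) `]0, +oo[%classic (measurable_itv _).
rewrite setTI -(measurable_subalgebraE (cF n.+1)); congr (filt n.+1 _).
apply/seteqP.
split => w; rewrite /= !in_itv/= !andbT (ord1 i);
  by rewrite lt_min lt_max ltxx ltr01 subr_gt0.
Qed.

Lemma measurable_BLip M L h : BLip M L h -> measurable_fun [set: H] h.
Proof.
move=> [L0 _ hL].
apply: (measurability _ (RGenOInfty.measurableE R)) => _ [_ [a ->] <-].
rewrite setTI; apply: open_measurable_mx; apply: open_enorm => v.
rewrite /= in_itv/= andbT => av; have L1 : 0 < L + 1 by rewrite ltr_wpDl.
exists ((h v - a) / (L + 1)); first by rewrite divr_gt0// subr_gt0.
move=> u; rewrite ltr_pdivlMr// => vu; rewrite /= in_itv/= andbT.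
have := hL v u; rewrite ler_norml => /andP[_ hvu].
by have := enorm_ge0 (v - u); lra.
Qed.

Lemma chain_measurable x0 x n : chain x0 x -> measurable_fun setT (x n).
Proof.
have [cF _ _ _] := noise.
by move/chain_adapted => /(_ n); exact: (adapted_measurable (cF n)).
Qed.

Definition transition M L h (y : H) := \int[nu]_s mcshane G K h M L (s, y).

Lemma Rintegral_step M L h x0 x n : BLip M L h -> chain x0 x ->
  \int[P]_w h (x n.+1 w) = \int[P]_w transition M L h (x n w).
Proof.
move=> bh cx; have [L0 hM hL] := bh; have [cF _ axi ind] := noise.
have mxi : measurable_fun setT (xi n) := adapted_measurable (cF n.+1) (axi n).
have mx := chain_measurable n cx.
have mF : measurable_fun setT (mcshane G K h M L).
  exact: measurable_mcshane.
transitivity (\int[P]_w mcshane G K h M L (xi n w, x n w)); last first.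
  have FM y : `|mcshane G K h M L y| <= M by exact: mcshane_bounded.
  rewrite /transition; apply: (independent_Rintegral mxi mx _ mF FM).
  by move=> A B mA mB; apply: ind => //; exact: (chain_adapted n cx).
apply/esym/ae_eq_Rintegral; last exact: (chain_mcshane n bh cx).
  by apply: (measurableT_comp mF); exact: measurable_fun_pair.
exact: (measurableT_comp (measurable_BLip bh) (chain_measurable n.+1 cx)).
Qed.

Variable X : H -> nat -> Omega -> H.
Hypothesis chainX : forall y, chain y (X y).

(** For an arbitrary noise value the McShane extension need not be [L]-Lipschitz in
the state.  From every starting point, however, the step is solvable for almost
every noise value, and there the step does not expand distances. *)
Lemma BLip_transition M L h : BLip M L h -> BLip M L (transition M L h).
Proof.
move=> bh; have [L0 hM hL] := bh.
have mhX y : measurable_fun setT (fun w => h (X y 1%N w)).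
  exact: (measurableT_comp (measurable_BLip bh) (chain_measurable 1 (chainX y))).
have tE y : transition M L h y = \int[P]_w h (X y 1%N w).
  rewrite (Rintegral_step 0 bh (chainX y)).
  under eq_Rintegral do rewrite (chainX y).1.
  by rewrite Rintegral_prob_cst.
have M0 : 0 <= M := le_trans (normr_ge0 _) (hM 0).
split=> // [y|y z]; first by rewrite tE; apply: ae_Rintegral_le => //; exact: aeW.
rewrite !tE; apply: (@ae_Rintegral_close _ _ _ _ _ _ M) => //.
  by rewrite mulr_ge0// enorm_ge0.
apply: filterS2 ((chainX y).2 0%N) ((chainX z).2 0%N) => w.
rewrite (chainX y).1 (chainX z).1 => Gy Gz.
apply: (le_trans (hL _ _)); rewrite ler_wpM2l// (le_trans (GP Gz Gy))//.
by rewrite subrr normr0 mulr0 addr0.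
Qed.

Lemma BLip_iter_transition M L h n :
  BLip M L h -> BLip M L (iter n (transition M L) h).
Proof. by move=> bh; elim: n => //= n; exact: BLip_transition. Qed.

Lemma Rintegral_iter M L h x0 x n : BLip M L h -> chain x0 x ->
  \int[P]_w h (x n w) = iter n (transition M L) h x0.
Proof.
move=> + cx; elim: n h => [|n IHn] h bh.
  under eq_Rintegral do rewrite cx.1.
  by rewrite Rintegral_prob_cst.
by rewrite (Rintegral_step n bh cx) IHn ?iterSr//; exact: BLip_transition.
Qed.

Lemma BLip_semigroup M L h n : BLip M L h ->
  BLip M L (fun y => \int[P]_w h (X y n w)).
Proof.
move=> bh; rewrite (_ : (fun y => _) = iter n (transition M L) h).
  exact: BLip_iter_transition.
by apply/funext => y; exact: Rintegral_iter.
Qed.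

(** Both sides are the iterate of order [l + n] of the transition operator at
[x0]. *)
Lemma markov_property M L h x0 x l n : BLip M L h -> chain x0 x ->
  \int[P]_w \int[P]_w' h (X (x l w) n w') = \int[P]_w h (x (l + n)%N w).
Proof.
move=> bh cx; rewrite (Rintegral_iter (l + n) bh cx) iterD.
rewrite -(Rintegral_iter l (BLip_iter_transition n bh) cx).
by apply: eq_Rintegral => w _; exact: (Rintegral_iter n bh (chainX _)).
Qed.

End markov.

(** * The domain has finite volume *)

Section finite_volume.
Variable R : realType.

Lemma measurable_box n (M : R) :
  measurable [set x : 'rV[R]_n | forall j, `|x ord0 j| <= M].
Proof.
rewrite (_ : [set x | _] =
    \bigcap_(j in [set: 'I_n]) [set x : 'rV[R]_n | `|x ord0 j| <= M]); last first.
  by apply/seteqP; split => [x xM j _|x xM j]; exact: xM.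
apply: fin_bigcap_measurable => // j _.
rewrite [X in measurable X](_ : _ =
    (fun x : 'rV[R]_n => `|x ord0 j|) @^-1` `]-oo, M]%classic); last first.
  by apply/seteqP; split => x /=; rewrite in_itv.
rewrite -[X in measurable X]setTI.
have mj : measurable_fun setT (fun x : 'rV[R]_n => `|x ord0 j|).
  by apply: measurableT_comp => //; exact: measurable_entry.
exact: mj.
Qed.

Lemma lebesgue_box n (M : R) :
  (lebesgue_rV R n [set x : 'rV[R]_n | forall j, `|x ord0 j| <= M]%R < +oo)%E.
Proof.
elim: n => [|n IHn].
  by rewrite /= diracE; case: (_ \in _); rewrite ltry.
rewrite /= /lebesgue_rV_succ /pushforward.
rewrite (_ : _ @^-1` _ = `[-M, M]%classic `*`
    [set x : 'rV[R]_n | forall j, `|x ord0 j| <= M]); last first.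
  apply/seteqP; split => -[s x] /=.
    move=> sx; split => [|j].
      by have := sx ord0; rewrite mxE unlift_none/= in_itv/= ler_norml.
    by have := sx (lift ord0 j); rewrite mxE liftK.
  rewrite in_itv/= -ler_norml => -[sM xM] j; rewrite mxE.
  by case: unliftP => [i _|_] //=; exact: xM.
rewrite product_measure2E//; last exact: measurable_box.
apply: lte_mul_pinfty => //.
have : @lebesgue_measure R `[-M, M]%classic \is a fin_num.
  by rewrite lebesgue_measure_itv; case: ifP.
exact.
Qed.

(** Boundedness of the domain is what puts bounded functions, and with them the
lift [g], into the Lebesgue spaces of all orders. *)
Lemma dx_finite d (O : polygonal_domain R d) : dx O setT \is a fin_num.
Proof.
rewrite ge0_fin_numE//.
change (lebesgue_rV R d (setT `&` dom O) < +oo)%E; rewrite setTI.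
have [M [_ /(_ (M + 1))]] := dom_bounded O; rewrite ltrDl => /(_ ltr01) OM.
apply: le_lt_trans (lebesgue_box d (M + 1)); apply: le_measure.
- by rewrite inE; apply: open_measurable_mx; exact: dom_open.
- by rewrite inE; exact: measurable_box.
- move=> x Ox j; apply: le_trans (OM x Ox).
  rewrite [leRHS]/Num.norm /= mx_normrE; apply/bigmax_geP; right => /=.
  by exists (ord0, j).
Qed.

End finite_volume.

(** * Integrable pairings *)

Section euclidean_complements.
Variables (R : realType) (m n : nat).
Implicit Types A B : 'M[R]_(m, n).

Lemma ler_entry_enorm A i j : `|A i j| <= enorm A.
Proof.
rewrite -sqrtr_sqr ler_wsqrtr// /mxdot (bigD1 i)//= (bigD1 j)//= -expr2.
rewrite -addrA lerDl addr_ge0// ?sumr_ge0// => k _.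
  by rewrite -expr2 sqr_ge0.
by apply: sumr_ge0 => l _; rewrite -expr2 sqr_ge0.
Qed.

Lemma enorm_le_sum A : enorm A <= \sum_i \sum_j `|A i j|.
Proof.
have S0 : 0 <= \sum_i \sum_j `|A i j| by apply: sumr_ge0 => i _; exact: sumr_ge0.
rewrite -[leRHS]ger0_norm// -sqrtr_sqr ler_wsqrtr// expr2 /mxdot mulr_suml.
apply: ler_sum => i _; rewrite mulr_suml; apply: ler_sum => j _.
rewrite (le_trans (ler_norm _))// normrM ler_wpM2l//.
rewrite (bigD1 i)//= (bigD1 j)//= -addrA lerDl addr_ge0// ?sumr_ge0// => k _.
by apply: sumr_ge0.
Qed.

Lemma mxdotNl A B : mxdot (- A) B = - mxdot A B.
Proof. by rewrite -scaleN1r mxdotZl mulN1r. Qed.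

Lemma mxdotBl A B C : mxdot (A - B) C = mxdot A C - mxdot B C.
Proof. by rewrite mxdotDl mxdotNl. Qed.

End euclidean_complements.

Section Lfun_complements.
Context d (T : measurableType d) (R : realType).
Variable mu : {measure set T -> \bar R}.
Implicit Types f g : T -> R.

Lemma Lfun_measurable r f : f \in Lfun mu r -> measurable_fun setT f.
Proof. by rewrite inE => /andP[/[!inE]]. Qed.

Lemma Lfun_le (r : R) f g : 1 <= r -> measurable_fun setT f ->
  (forall x, `|f x| <= g x) -> g \in Lfun mu r%:E -> f \in Lfun mu r%:E.
Proof.
move=> r1 mf fg gL; have r0 : 0 < r := lt_le_trans ltr01 r1.
rewrite inE; apply/andP; split; rewrite inE//= /finite_norm unlock.
have /integrableP[mg gfin] := Lfun_integrable r1 gL.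
rewrite poweR_lty//; apply: le_lt_trans gfin; apply: ge0_le_integral => //.
- by move=> x _; exact: poweR_ge0.
- apply: (measurableT_comp (measurable_poweR _)).
  by apply: measurableT_comp => //; exact/measurable_EFinP.
- by apply: measurableT_comp.
- move=> x _; rewrite /= lee_fin [leRHS]ger0_norm ?powR_ge0//.
  by rewrite ge0_ler_powR ?nnegrE ?(ltW r0)// (le_trans (fg x))// ler_norm.
Qed.

Lemma Lfun_mul (p q : R) f g : 0 < p -> 0 < q -> p^-1 + q^-1 = 1 ->
  f \in Lfun mu p%:E -> g \in Lfun mu q%:E -> f \* g \in Lfun mu 1.
Proof.
move=> p0 q0 pq fL gL.
have [mf mg] := (Lfun_measurable fL, Lfun_measurable gL).
rewrite inE; apply/andP; split; rewrite inE/=; first exact: measurable_funM.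
rewrite /finite_norm (le_lt_trans (hoelder mu mf mg p0 q0 pq))//.
move: fL gL; rewrite !inE => /andP[_ /[!inE] fL] /andP[_ /[!inE] gL].
apply: lte_mul_pinfty => //; first exact: Lnorm_ge0.
by rewrite ge0_fin_numE ?Lnorm_ge0.
Qed.

Lemma Lfuny_mul f g :
  f \in Lfun mu +oo -> g \in Lfun mu 1 -> f \* g \in Lfun mu 1.
Proof.
move=> fL gL; have [mf mg] := (Lfun_measurable fL, Lfun_measurable gL).
have [C fC] : exists C, {ae mu, forall x, `|f x| <= C}.
  move: fL; rewrite inE => /andP[_]; rewrite inE/= /finite_norm unlock /Lnorm.
  case: ifPn => [_|mu0 _]; first exact: ess_supr_bounded.
  exists 0, setT; split=> //; apply/eqP; rewrite eq_le measure_ge0 andbT.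
  by rewrite leNgt.
have /integrableP[_ gfin] := (Lfun1_integrable mu g).1 gL.
apply/Lfun1_integrable/integrableP; split.
  by apply/measurable_EFinP; exact: measurable_funM.
have gn : (\int[mu]_x (`|C| * `|g x|)%:E < +oo)%E.
  under eq_integral do rewrite EFinM.
  rewrite ge0_integralZl//; last by apply/measurable_EFinP; exact: measurableT_comp.
  by rewrite lte_mul_pinfty.
apply: le_lt_trans gn; apply: ae_ge0_le_integral => //.
- apply/measurable_EFinP; apply: measurableT_comp => //.
  exact: measurable_funM.
- by apply/measurable_EFinP; apply: measurable_funM => //; exact: measurableT_comp.
- apply: filterS fC => x fx _; rewrite /= lee_fin normrM ler_wpM2r//.
  exact: le_trans fx (ler_norm _).
Qed.

End Lfun_complements.

Section pairing.
Context d (T : measurableType d) (R : realType).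
Variables (mu : {measure set T -> \bar R}) (m n : nat).
Implicit Types u v w : T -> 'M[R]_(m, n).

Definition mintegrable u v :=
  mu.-integrable setT (EFin \o (fun x => mxdot (u x) (v x))).

Lemma mpairC u v : mpair mu u v = mpair mu v u.
Proof. by apply: eq_Rintegral => x _; rewrite mxdotC. Qed.

Lemma mintegrableC u v : mintegrable u v -> mintegrable v u.
Proof. by apply: eq_integrable => // x _ /=; rewrite mxdotC. Qed.

Lemma mintegrableDl u v w : mintegrable u w -> mintegrable v w ->
  mintegrable (fun x => u x + v x) w.
Proof.
move=> uw vw; apply: eq_integrable (integrableD _ uw vw) => // x _ /=.
by rewrite mxdotDl EFinD.
Qed.

Lemma mintegrableZl a u w : mintegrable u w -> mintegrable (fun x => a *: u x) w.
Proof.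
move=> uw; apply: eq_integrable (integrableZl _ a uw) => // x _ /=.
by rewrite mxdotZl EFinM.
Qed.

Lemma mpairDl u v w : mintegrable u w -> mintegrable v w ->
  mpair mu (fun x => u x + v x) w = mpair mu u w + mpair mu v w.
Proof.
move=> uw vw; rewrite /mpair -RintegralD//.
by apply: eq_Rintegral => x _; rewrite mxdotDl.
Qed.

Lemma mpairZl a u w : mintegrable u w ->
  mpair mu (fun x => a *: u x) w = a * mpair mu u w.
Proof.
move=> uw; rewrite /mpair -RintegralZl//.
by apply: eq_Rintegral => x _; rewrite mxdotZl.
Qed.

Lemma mpairBl u v w : mintegrable u w -> mintegrable v w ->
  mpair mu (fun x => u x - v x) w = mpair mu u w - mpair mu v w.
Proof.
move=> uw vw; rewrite /mpair -RintegralB//.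
by apply: eq_Rintegral => x _; rewrite mxdotBl.
Qed.

Lemma Lp_fieldsP (r : R) u : Lp_fields mu r%:E u ->
  measurable_fun setT u /\ (fun x => enorm (u x)) \in Lfun mu r%:E.
Proof.
move=> [mu_ ur]; split=> //; rewrite inE; apply/andP; split; rewrite inE//=.
exact: measurable_enorm.
Qed.

Lemma Lp_fields_entry (r : R) u i j : 1 <= r -> Lp_fields mu r%:E u ->
  (fun x => u x i j) \in Lfun mu r%:E.
Proof.
move=> r1 /Lp_fieldsP[mu_ uL]; apply: Lfun_le uL => // [|x].
  exact: (measurableT_comp (measurable_entry i j)).
exact: ler_entry_enorm.
Qed.

Lemma mintegrable_entries u v :
  (forall i j, (fun x => u x i j * v x i j) \in Lfun mu 1) -> mintegrable u v.
Proof.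
move=> uv.
have I i j : mu.-integrable setT (fun x => (u x i j * v x i j)%:E).
  exact/Lfun1_integrable/uv.
have J : mu.-integrable setT
    (fun x => \sum_i \sum_j (u x i j * v x i j)%:E)%E.
  apply: integrable_sum => // i _; apply: integrable_sum => // j _; exact: I.
apply: eq_integrable J => // x _ /=; rewrite /mxdot -sumEFin.
by apply: eq_bigr => i _; rewrite sumEFin.
Qed.

Lemma mintegrable_Lp (p q : R) u v : 1 < p -> 1 < q -> p^-1 + q^-1 = 1 ->
  Lp_fields mu p%:E u -> Lp_fields mu q%:E v -> mintegrable u v.
Proof.
move=> p1 q1 pq uL vL; apply: mintegrable_entries => i j.
have := Lfun_mul (lt_trans ltr01 p1) (lt_trans ltr01 q1) pq
  (Lp_fields_entry i j (ltW p1) uL) (Lp_fields_entry i j (ltW q1) vL).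
exact.
Qed.

End pairing.

(** * The flux is monotone and of order p - 1 *)

Section flux.
Variables (R : realType) (d : nat) (p kappa : R).
Hypotheses (p_gt1 : 1 < p) (kappa_ge0 : 0 <= kappa).

Local Notation psi a := ((kappa + a ^+ 2) `^ ((p - 2) / 2) * a).

Lemma enorm_scale m n (a : R) (A : 'M[R]_(m, n)) :
  enorm (a *: A) = `|a| * enorm A.
Proof.
by rewrite /enorm mxdotZl mxdotC mxdotZl mulrA -expr2 sqrtrM ?sqr_ge0// sqrtr_sqr.
Qed.

Lemma enorm_Sp (A : 'M[R]_d) : enorm (Sp p kappa A) = psi (enorm A).
Proof. by rewrite enorm_scale ger0_norm// powR_ge0. Qed.

(** With [q = kappa + a ^+ 2] the number [a] is at most the square root of [q], so
the first factor is at most [q `^ ((p - 1) / 2)]; and the square root of [q] is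
at most [Num.sqrt kappa + a].  This treats [p < 2] and [p >= 2] together. *)
Lemma flux_growth (a b : R) : 0 <= a -> 0 <= b ->
  psi a * b <= (Num.sqrt kappa + a + b) `^ p.
Proof.
move=> a0 b0; have s0 : 0 <= Num.sqrt kappa by exact: sqrtr_ge0.
set s := Num.sqrt kappa in s0 *.
have [->|a_neq0] := eqVneq a 0; first by rewrite mulr0 mul0r powR_ge0.
have {}a0 : 0 < a by rewrite lt_neqAle eq_sym a_neq0.
pose q := kappa + a ^+ 2.
have q0 : 0 < q by rewrite ltr_wpDl// exprn_gt0.
have aq : a <= q `^ 2^-1.
  rewrite (powR12_sqrt (ltW q0)) -[leLHS](ger0_norm (ltW a0)) -sqrtr_sqr ler_wsqrtr//.
  by rewrite lerDr.
have qs : q `^ 2^-1 <= s + a.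
  rewrite (powR12_sqrt (ltW q0)) -[leRHS](ger0_norm (addr_ge0 s0 (ltW a0))) -sqrtr_sqr.
  rewrite ler_wsqrtr// /q sqrrD sqr_sqrtr//.
  by have := mulr_ge0 s0 (ltW a0); lra.
have p1 : 0 <= p - 1 by rewrite subr_ge0 ltW.
have -> : p = (p - 1) + 1 by rewrite subrK.
rewrite powRD; last by apply/implyP => _; rewrite gt_eqF// ltr_wpDr// ltr_wpDl.
rewrite powRr1; last by rewrite !addr_ge0// ltW.
apply: ler_pM => //; [by rewrite mulr_ge0 ?powR_ge0// ltW| |].
- apply: (@le_trans _ _ (q `^ 2^-1 `^ (p - 1))).
    rewrite -powRrM [_ * (p - 1)](_ : _ = (p - 2) / 2 + 2^-1); last by field.
    rewrite powRD; last by apply/implyP => _; rewrite gt_eqF.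
    by rewrite subrK -/q ler_wpM2l// powR_ge0.
  apply: ge0_ler_powR => //; first by rewrite nnegrE powR_ge0.
    by rewrite nnegrE !addr_ge0// ltW.
  by apply: (le_trans qs); rewrite lerDl.
- by rewrite lerDr addr_ge0// ltW.
Qed.

(** For [p < 2] the weight decreases, but [kappa + a ^+ 2] grows at most by the
factor [(b / a) ^+ 2], and the exponent [(2 - p) / 2] is at most [1 / 2]. *)
Lemma flux_nondecreasing (a b : R) : 0 <= a -> a <= b -> psi a <= psi b.
Proof.
move=> a0 ab; have b0 : 0 <= b := le_trans a0 ab.
have [->|a_neq0] := eqVneq a 0; first by rewrite mulr0 mulr_ge0 ?powR_ge0.
have {a_neq0}a0 : 0 < a by rewrite lt_neqAle eq_sym a_neq0.
have a2b2 : a ^+ 2 <= b ^+ 2 by rewrite ler_sqr// nnegrE ltW.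
have {}b0 := lt_le_trans a0 ab.
set qa := kappa + a ^+ 2; set qb := kappa + b ^+ 2.
have qa0 : 0 < qa by rewrite ltr_wpDl// exprn_gt0.
have qb0 : 0 < qb by rewrite ltr_wpDl// exprn_gt0.
have qab : qa <= qb by rewrite lerD2l.
have [p2|p2] := leP 2 p.
  apply: ler_pM => //; [exact: powR_ge0|exact: ltW|].
  apply: ge0_ler_powR => //; [by rewrite divr_ge0// subr_ge0|..];
    by rewrite nnegrE ltW.
pose t : R := (2 - p) / 2.
have -> : (p - 2) / 2 = - t by rewrite /t; field.
have t0 : 0 <= t by rewrite /t; lra.
pose r : R := b / a.
have r1 : 1 <= r by rewrite ler_pdivlMr// mul1r.
have r0 : 0 <= r := le_trans ler01 r1.
have qbr : qb <= r ^+ 2 * qa.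
  rewrite /qa mulrDr /r expr_div_n divfK ?expf_neq0 ?gt_eqF// lerD2r.
  by rewrite ler_peMl// -expr_div_n exprn_ege1.
have rt : qb `^ t <= r * qa `^ t.
  apply: (@le_trans _ _ ((r ^+ 2 * qa) `^ t)).
    apply: ge0_ler_powR => //; rewrite nnegrE; first exact: ltW.
    by rewrite mulr_ge0 ?exprn_ge0// ltW.
  rewrite powRM ?exprn_ge0 ?(ltW qa0)// ler_wpM2r ?powR_ge0//.
  rewrite -powR_mulrn// -powRrM -[leRHS](powRr1 r0).
  apply: ler_powR => //.
  by rewrite /t mulrC divfK// lerBlDr -[leLHS]/(1 + 1) lerD2l ltW.
rewrite !powRN ![_^-1 * _]mulrC ler_pdivrMr ?powR_gt0// mulrAC.
rewrite ler_pdivlMr ?powR_gt0//.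
have : a * qb `^ t <= a * (r * qa `^ t) by rewrite ler_wpM2l// ltW.
by rewrite mulrA /r mulrCA divff ?mulr1// gt_eqF.
Qed.

(** By the Cauchy-Schwarz inequality this reduces to radial monotonicity, which is
[flux_nondecreasing]. *)
Lemma Sp_monotone (A B : 'M[R]_d) :
  0 <= mxdot (Sp p kappa A - Sp p kappa B) (A - B).
Proof.
have := mxdot_le A B; set ab := mxdot A B => abAB.
set fA := (kappa + enorm A ^+ 2) `^ ((p - 2) / 2).
set fB := (kappa + enorm B ^+ 2) `^ ((p - 2) / 2).
have -> : mxdot (Sp p kappa A - Sp p kappa B) (A - B) =
    fA * enorm A ^+ 2 + fB * enorm B ^+ 2 - (fA + fB) * ab.
  rewrite /Sp -/fA -/fB mxdotBl !mxdotZl ![mxdot _ (A - B)]mxdotC !mxdotBl.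
  by rewrite !enorm_sqr [mxdot B A]mxdotC -/ab; ring.
have fA0 : 0 <= fA by exact: powR_ge0.
have fB0 : 0 <= fB by exact: powR_ge0.
have H : 0 <= (fA * enorm A - fB * enorm B) * (enorm A - enorm B).
  have [AB|/ltW BA] := leP (enorm A) (enorm B).
    rewrite mulr_le0// ?subr_le0//.
    exact: (flux_nondecreasing (enorm_ge0 A)).
  by rewrite mulr_ge0// subr_ge0//; exact: (flux_nondecreasing (enorm_ge0 B)).
have : (fA + fB) * ab <= (fA + fB) * (enorm A * enorm B).
  by rewrite ler_wpM2l// addr_ge0.
by nra.
Qed.

End flux.

(** * Closure properties of the Lebesgue spaces, and weak gradients *)

Section Lfun_closure.
Context d (T : measurableType d) (R : realType).
Variables (mu : {measure set T -> \bar R}) (r : \bar R).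
Hypothesis r_ge1 : (1 <= r)%E.
Implicit Types f g : T -> R.

Lemma Lfun_add f g : f \in Lfun mu r -> g \in Lfun mu r ->
  (fun x => f x + g x) \in Lfun mu r.
Proof. by move=> fL gL; exact: (Lfun_addr_closed mu r_ge1).2. Qed.

Lemma Lfun_scaler a f : f \in Lfun mu r -> (fun x => a * f x) \in Lfun mu r.
Proof.
move=> fL; have [_ /(_ a _ _ fL)] := Lfun_submod_closed mu r_ge1.
move/(_ 0 (Lfun_addr_closed mu r_ge1).1).
by rewrite addr0.
Qed.

Lemma Lfun_sum (I : finType) (h : I -> T -> R) :
  (forall i, h i \in Lfun mu r) -> (fun x => \sum_i h i x) \in Lfun mu r.
Proof.
move=> hL; elim: (index_enum I) => [|i s IHs].
  under eq_fun do rewrite big_nil.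
  exact: (Lfun_addr_closed mu r_ge1).1.
under eq_fun do rewrite big_cons.
exact: Lfun_add.
Qed.

Lemma Lfun_abs f : f \in Lfun mu r -> (fun x => `|f x|) \in Lfun mu r.
Proof.
case/andP; rewrite !inE/= => mf finf; apply/andP; split.
  by rewrite inE/=; exact: measurableT_comp.
by rewrite inE/= /finite_norm -[X in Lnorm _ _ X]/(abse \o (EFin \o f)) Lnorm_abse.
Qed.

End Lfun_closure.

Lemma Lfun_constant d (T : measurableType d) (R : realType)
    (mu : {measure set T -> \bar R}) (r c : R) :
  mu setT \is a fin_num -> (fun=> c) \in Lfun mu r%:E.
Proof.
move=> mufin; rewrite inE; apply/andP; split; rewrite inE//= /finite_norm unlock.
rewrite poweR_lty//= integral_cst//.
by rewrite -(fineK mufin) -EFinM ltry.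
Qed.

Section transport.
Context d (T : measurableType d) (R : realType).
Variables (mu : {measure set T -> \bar R}) (m n : nat).

Lemma mintegrable_transport (s : T -> 'rV[R]_m) (A : T -> 'M[R]_(m, n))
    (v : T -> 'rV[R]_n) :
  (forall j, (fun x => s x ord0 j) \in Lfun mu +oo) ->
  (forall j l, (fun x => A x j l * v x ord0 l) \in Lfun mu 1) ->
  mintegrable mu (fun x => s x *m A x) v.
Proof.
move=> sL AL; apply: mintegrable_entries => i l; rewrite (ord1 i).
under eq_fun do rewrite mxE mulr_suml.
apply: Lfun_sum => // j.
rewrite (_ : (fun x => _) =
    (fun x => s x ord0 j) \* (fun x => A x j l * v x ord0 l)).
  exact: Lfuny_mul.
by apply/funext => x /=; rewrite mulrA.
Qed.

End transport.

Section weak_gradient.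
Variables (R : realType) (d : nat) (O : polygonal_domain R d).

Lemma component_Lfun k r (u : 'rV[R]_d -> 'rV[R]_d) i :
  Sobolev_field O k r u -> (fun x => u x ord0 i) \in Lfun (dx O) r.
Proof. by move=> /(_ i) []. Qed.

Lemma weak_grad_Lfun k r (u : 'rV[R]_d -> 'rV[R]_d) i j :
  Sobolev_field O k.+1 r u ->
  (fun x => weak_grad O r u x i j) \in Lfun (dx O) r.
Proof.
move=> /(_ j) [_ /(_ [:: i] isT) ex].
have [wL _] := xgetPex (cst 0) ex.
by rewrite (_ : (fun x => _) = weak_deriv O r [:: i] (component u j));
  [exact: wL|apply/funext => x; rewrite mxE].
Qed.

Lemma sym_grad_Lfun k r (u : 'rV[R]_d -> 'rV[R]_d) i j : (1 <= r)%E ->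
  Sobolev_field O k.+1 r u -> (fun x => sym_grad O r u x i j) \in Lfun (dx O) r.
Proof.
move=> r1 uS; rewrite (_ : (fun x => _) = fun x =>
    2^-1 * (weak_grad O r u x i j + weak_grad O r u x j i)); last first.
  by apply/funext => x; rewrite /sym_grad !mxE.
by apply: Lfun_scaler => //; apply: Lfun_add => //; exact: weak_grad_Lfun.
Qed.

End weak_gradient.

(** * Orthonormal bases of inner product spaces *)

Lemma linear_form_sum (R : realType) (V : lmodType R) (f : V -> R) :
  (forall c u v, f (c *: u + v) = c * f u + f v) ->
  forall (I : finType) (c : I -> R) (e : I -> V),
    f (\sum_i c i *: e i) = \sum_i c i * f (e i).
Proof.
move=> fL I c e; elim: (index_enum I) => [|i s IHs].
  by rewrite !big_nil; have := fL (-1) 0 0; rewrite scaler0 addr0; lra.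
by rewrite !big_cons fL IHs.
Qed.

Section orthonormal.
Variables (R : realType) (V : vectType R) (E : set V) (a : V -> V -> R).
Hypothesis E_linear : forall c u v, E u -> E v -> E (c *: u + v).
Hypothesis E_0 : E 0.
Hypothesis aC : forall u v, a u v = a v u.
Hypothesis a_linear : forall c u v w, a (c *: u + v) w = c * a u w + a v w.
Hypothesis a_ge0 : forall v, 0 <= a v v.
Hypothesis a_definite : forall v, E v -> a v v = 0 -> v = 0.

Definition orthonormal_family k (e : 'I_k -> V) :=
  (forall i, E (e i)) /\ forall i j, a (e i) (e j) = (i == j)%:R.

Let a_sum (I : finType) (c : I -> R) (e : I -> V) w :
  a (\sum_i c i *: e i) w = \sum_i c i * a (e i) w.
Proof. by apply: (@linear_form_sum _ _ (a ^~ w)) => ? ? ?; exact: a_linear. Qed.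

Lemma span_mem (I : finType) (c : I -> R) (e : I -> V) :
  (forall i, E (e i)) -> E (\sum_i c i *: e i).
Proof.
move=> Ee; elim: (index_enum I) => [|i s IHs]; first by rewrite big_nil.
by rewrite big_cons; exact: E_linear.
Qed.

Lemma orthonormal_coord k (e : 'I_k -> V) (c : 'I_k -> R) j :
  orthonormal_family e -> a (\sum_i c i *: e i) (e j) = c j.
Proof.
move=> [_ eE]; rewrite a_sum (bigD1 j)//= eE eqxx mulr1 big1 ?addr0// => i ij.
by rewrite eE (negbTE ij) mulr0.
Qed.

(** Orthonormal families are free. *)
Lemma orthonormal_size k (e : 'I_k -> V) : orthonormal_family e -> (k <= \dim {:V})%N.
Proof.
move=> oe; have fe : free [tuple e i | i < k].
  apply/freeP => c c0 j.
  rewrite -(orthonormal_coord c j oe); transitivity (a 0 (e j)).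
    congr (a _ _); rewrite -[RHS]c0; apply: eq_bigr => i _.
    by rewrite -tnth_nth tnth_mktuple.
  by have := a_linear (-1) 0 0 (e j); rewrite scaler0 addr0; lra.
move: fe; rewrite /free size_tuple => /eqP <-; exact/dimvS/subvf.
Qed.

(** One step of the Gram-Schmidt process. *)
Lemma orthonormal_extend k (e : 'I_k -> V) v : orthonormal_family e -> E v ->
  v <> \sum_i a v (e i) *: e i -> exists e' : 'I_k.+1 -> V, orthonormal_family e'.
Proof.
move=> oe Ev nv; pose s := \sum_i a v (e i) *: e i.
pose r := -1 *: s + v.
have Er : E r by apply: E_linear => //; apply: span_mem; exact: oe.1.
have re j : a r (e j) = 0.
  by rewrite a_linear (orthonormal_coord _ _ oe) mulN1r addNr.
have r0 : 0 < a r r.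
  rewrite lt_neqAle a_ge0 andbT; apply/eqP => /esym /(a_definite Er) r0.
  by apply: nv; apply/eqP; rewrite -subr_eq0 addrC -scaleN1r -/s -/r r0.
pose q := (Num.sqrt (a r r))^-1.
have aZ c u w : a (c *: u) w = c * a u w.
  have := a_linear c u 0 w; have := a_linear (-1) 0 0 w.
  by rewrite scaler0 !addr0 => ? ->; lra.
exists (fun i => oapp e (q *: r) (unlift ord0 i)); split=> [i|i j].
  case: unliftP => [i' _|_] /=; first exact: oe.1.
  by rewrite -[_ *: _]addr0; exact: E_linear.
case: unliftP => [i' ->|->]; case: unliftP => [j' ->|->] /=.
- by rewrite oe.2 (inj_eq lift_inj).
- by rewrite aC aZ re mulr0.
- by rewrite aZ re mulr0.
- rewrite aZ aC aZ mulrA -expr2 exprVn sqr_sqrtr ?(ltW r0)//.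
  by rewrite mulVf// gt_eqF.
Qed.

(** An orthonormal family of maximal size spans, since otherwise it could be
extended. *)
Lemma orthonormal_basis : exists k (e : 'I_k -> V), orthonormal_family e /\
  forall v, E v -> v = \sum_i a v (e i) *: e i.
Proof.
pose Q k := `[< exists e : 'I_k -> V, orthonormal_family e >].
have exQ : exists k, Q k.
  exists 0%N; apply/asboolP; exists (fun=> 0); split => // -[]//.
have Qub k : Q k -> (k <= \dim {:V})%N.
  by move=> /asboolP[e]; exact: orthonormal_size.
case: (ex_maxnP exQ Qub) => k /asboolP[e oe] kmax; exists k, e; split => // v Ev.
apply: contrapT => nv; suff : Q k.+1 by move=> /kmax; rewrite ltnn.
by apply/asboolP; exact: orthonormal_extend nv.
Qed.

End orthonormal.

(** * The time step without pressure *)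

Section pairing_linear.
Context d (T : measurableType d) (R : realType).
Variables (mu : {measure set T -> \bar R}) (m n : nat) (V : lmodType R).
Variables (F : V -> T -> 'M[R]_(m, n)) (w : T -> 'M[R]_(m, n)).
Hypothesis F_linear : forall a u v x, F (a *: u + v) x = a *: F u x + F v x.
Hypothesis Fw : forall v, mintegrable mu (F v) w.

Lemma mpair_linearl a u v :
  mpair mu (F (a *: u + v)) w = a * mpair mu (F u) w + mpair mu (F v) w.
Proof.
rewrite -mpairZl// -mpairDl//; last exact: mintegrableZl.
by congr mpair; apply/funext => x; exact: F_linear.
Qed.

Lemma mpair_linearr a u v :
  mpair mu w (F (a *: u + v)) = a * mpair mu w (F u) + mpair mu w (F v).
Proof. by rewrite ![mpair mu w _]mpairC mpair_linearl. Qed.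

End pairing_linear.

Section scheme.
Variables (R : realType) (d : nat) (O : polygonal_domain R d) (p kappa tau : R).
Variables (g sigma : 'rV[R]_d -> 'rV[R]_d) (D : gradDisc O p).
Hypotheses (p_gt1 : 1 < p) (kappa_ge0 : 0 <= kappa) (tau_gt0 : 0 < tau).
Hypotheses (gW : Sobolev_field O 2 +oo g) (sigmaW : Sobolev_field O 1 +oo sigma).
Local Notation mu := (dx O).
Local Notation p' := (dual_exp p).
Local Notation L2 := (L2field mu d).

Let p'_gt1 : 1 < p'.
Proof. by rewrite /dual_exp ltr_pdivlMr ?subr_gt0// mul1r gtrBl. Qed.

Let conj_p : p^-1 + p'^-1 = 1.
Proof.
rewrite /dual_exp invf_div; have p0 : p != 0 by rewrite gt_eqF// (lt_trans ltr01).
by field.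
Qed.

Let conj_2 : 2^-1 + 2^-1 = 1 :> R. Proof. by field. Qed.

Let p_in : p \in [:: p; p']. Proof. by rewrite inE eqxx. Qed.
Let p'_in : p' \in [:: p; p']. Proof. by rewrite !inE eqxx orbT. Qed.
Let Lfuny_sub (r : R) f : 1 < r -> f \in Lfun mu +oo -> f \in Lfun mu r%:E.
Proof.
move=> r1 fL; apply: Lfun_subset fL; rewrite ?lee_fin ?(ltW r1) ?leey//.
exact: dx_finite.
Qed.

Let linE m n (V : lmodType R) (F : {linear V -> ('rV[R]_d -> 'M[R]_(m, n))})
  a u v x : F (a *: u + v) x = a *: F u x + F v x.
Proof. by rewrite linearP. Qed.

Let linE1 (V : lmodType R) (F : {linear V -> ('rV[R]_d -> R)}) a u v x :
  F (a *: u + v) x = a * F u x + F v x.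
Proof. by rewrite linearP. Qed.

Definition gdform (v xi : gdX D) : R := mpair mu (gdPi D v) (gdPi D xi).

Lemma Pi_L2 v : Lp_fields mu 2%:E (gdPi D v).
Proof. by apply: gdPiP; rewrite inE eqxx. Qed.

Lemma mintegrable_L2 (u v : 'rV[R]_d -> 'rV[R]_d) : Lp_fields mu 2%:E u ->
  Lp_fields mu 2%:E v -> mintegrable mu u v.
Proof. by apply: (mintegrable_Lp (p := 2) (q := 2)) => //; rewrite ltr1n. Qed.

Lemma mintegrable_Pi v xi : mintegrable mu (gdPi D v) (gdPi D xi).
Proof. by apply: mintegrable_L2; exact: Pi_L2. Qed.

Lemma gdformC v xi : gdform v xi = gdform xi v.
Proof. exact: mpairC. Qed.

Lemma gdform_linear a u v xi :
  gdform (a *: u + v) xi = a * gdform u xi + gdform v xi.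
Proof.
apply: (mpair_linearl (F := fun v => gdPi D v)); last first.
  by move=> w; exact: mintegrable_Pi.
by move=> *; exact: linE.
Qed.

Lemma gdformD u v xi : gdform (u + v) xi = gdform u xi + gdform v xi.
Proof. by rewrite -[u in LHS]scale1r gdform_linear mul1r. Qed.

Lemma gdformB u v xi : gdform (u - v) xi = gdform u xi - gdform v xi.
Proof. by rewrite addrC -scaleN1r gdform_linear mulN1r addrC. Qed.

Lemma gdformZ a u xi : gdform (a *: u) xi = a * gdform u xi.
Proof.
have z : gdform 0 xi = 0 by rewrite -(subrr u) gdformB subrr.
by rewrite -[a *: u]addr0 gdform_linear z addr0.
Qed.

Lemma gdform_ge0 v : 0 <= gdform v v.
Proof. by apply: Rintegral_ge0 => x _; exact: mxdot_ge0. Qed.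

(** The stress is integrable against discrete strains because of its growth
of order [p - 1]. *)
Lemma mintegrable_stress v xi : mintegrable mu
  (fun x => Sp p kappa (gdeps D v x + sym_grad O +oo g x)) (gdeps D xi).
Proof.
have p1 := ltW p_gt1; have pe1 : (1 <= p%:E)%E by rewrite lee_fin.
have [meps epsL] := Lp_fieldsP (gdepsP v p_in).
have [mxi xiL] := Lp_fieldsP (gdepsP xi p_in).
have egL i j : (fun x => sym_grad O +oo g x i j) \in Lfun mu p%:E.
  by apply: Lfuny_sub => //; apply: (sym_grad_Lfun _ _ _ gW); exact: leey.
have meg : measurable_fun setT (sym_grad O +oo g).
  by apply: measurable_fun_mx => i j; exact: Lfun_measurable (egL i j).
have eg1L : (fun x => enorm (sym_grad O +oo g x)) \in Lfun mu p%:E.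
  apply: (@Lfun_le _ _ _ _ _ _
    (fun x => \sum_i \sum_j `|sym_grad O +oo g x i j|)) => //.
  - exact: measurable_enorm.
  - by move=> x; rewrite ger0_norm ?enorm_ge0//; exact: enorm_le_sum.
  - by apply: Lfun_sum => // i; apply: Lfun_sum => // j; exact: Lfun_abs.
pose Z x := Num.sqrt kappa + (enorm (gdeps D v x) + enorm (sym_grad O +oo g x)) +
  enorm (gdeps D xi x).
have ZL : Z \in Lfun mu p%:E.
  do 2 apply: Lfun_add => //; last exact: Lfun_add.
  by apply: Lfun_constant => //; exact: dx_finite.
pose S x := Sp p kappa (gdeps D v x + sym_grad O +oo g x).
have mA : measurable_fun setT (fun x => gdeps D v x + sym_grad O +oo g x).
  exact: measurable_mxD.
have mS i j : measurable_fun setT (fun x => S x i j).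
  under eq_fun do rewrite mxE.
  apply: measurable_funM; last exact: (measurableT_comp (measurable_entry i j)).
  apply: (measurableT_comp (measurable_powR _)).
  apply: measurable_funD => //; apply: measurable_funX.
  exact: measurable_enorm.
apply: mintegrable_entries => i j.
have Zp : (fun x => `|Z x| `^ p) \in Lfun mu 1.
  exact/Lfun1_integrable/(Lfun_integrable p1 ZL).
apply: (@Lfun_le _ _ _ _ 1 _ (fun x => `|Z x| `^ p)) => // [|x].
  apply: measurable_funM; first exact: mS.
  exact: (measurableT_comp (measurable_entry i j)).
have Z0 : 0 <= Z x by rewrite !addr_ge0 ?enorm_ge0// sqrtr_ge0.
rewrite normrM (ger0_norm Z0).
apply: (@le_trans _ _ (enorm (S x) * enorm (gdeps D xi x))).
  by apply: ler_pM => //; exact: ler_entry_enorm.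
rewrite /S enorm_Sp.
apply: le_trans (flux_growth p_gt1 kappa_ge0 (enorm_ge0 _) (enorm_ge0 _)) _.
apply: ge0_ler_powR; rewrite ?nnegrE ?addr_ge0 ?enorm_ge0 ?sqrtr_ge0//.
  exact: le_trans ler01 p1.
by rewrite lerD2r lerD2l enormD.
Qed.

Lemma mintegrable_transport_grad v xi :
  mintegrable mu (fun x => sigma x *m gdgrad D v x) (gdPi D xi).
Proof.
apply: mintegrable_transport => [j|j l]; first exact: component_Lfun sigmaW.
have := Lfun_mul (lt_trans ltr01 p_gt1) (lt_trans ltr01 p'_gt1) conj_p
  (Lp_fields_entry j l (ltW p_gt1) (gdgradP v p_in))
  (Lp_fields_entry ord0 l (ltW p'_gt1) (gdPiP xi _)).
by apply; rewrite !inE eqxx !orbT.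
Qed.

Lemma mintegrable_transport_lift xi :
  mintegrable mu (fun x => sigma x *m weak_grad O +oo g x) (gdPi D xi).
Proof.
apply: mintegrable_transport => [j|j l]; first exact: component_Lfun sigmaW.
have lt12 : 1 < 2 :> R by rewrite ltr1n.
have := Lfun_mul (lt_trans ltr01 lt12) (lt_trans ltr01 lt12) conj_2
  (Lfuny_sub lt12 (weak_grad_Lfun j l gW))
  (Lp_fields_entry ord0 l (ltW lt12) (Pi_L2 xi)).
exact.
Qed.

Definition gdstress (m xi : gdX D) : R := mpair mu
  (fun x => Sp p kappa (gdeps D m x + sym_grad O +oo g x)) (gdeps D xi).

Definition gdload (m xi : gdX D) : R := Bsigma sigma m xi +
  mpair mu (fun x => sigma x *m weak_grad O +oo g x) (gdPi D xi).

Let transport_linear a u v x : sigma x *m gdgrad D (a *: u + v) x =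
  a *: (sigma x *m gdgrad D u x) + sigma x *m gdgrad D v x.
Proof. by rewrite linE mulmxDr -scalemxAr. Qed.

Let Pi_linear a u v x : gdPi D (a *: u + v) x = a *: gdPi D u x + gdPi D v x.
Proof. exact: linE. Qed.

Lemma Bsigma_linearl a (u v xi : gdX D) :
  Bsigma sigma (a *: u + v) xi = a * Bsigma sigma u xi + Bsigma sigma v xi.
Proof.
rewrite /Bsigma (mpair_linearl (F := fun v x => sigma x *m gdgrad D v x))//;
  last by move=> w; exact: mintegrable_transport_grad.
rewrite (mpair_linearl (F := fun v => gdPi D v))//; first by ring.
by move=> w; apply/mintegrableC/mintegrable_transport_grad.
Qed.

Lemma Bsigma_linearr a (u v xi : gdX D) :
  Bsigma sigma xi (a *: u + v) = a * Bsigma sigma xi u + Bsigma sigma xi v.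
Proof.
rewrite /Bsigma (mpair_linearr (F := fun v x => sigma x *m gdgrad D v x))//;
  last by move=> w; exact: mintegrable_transport_grad.
rewrite (mpair_linearr (F := fun v => gdPi D v))//; first by ring.
by move=> w; apply/mintegrableC/mintegrable_transport_grad.
Qed.

Lemma Bsigma_skew (v : gdX D) : Bsigma sigma v v = 0.
Proof. by rewrite /Bsigma mpairC subrr. Qed.

Lemma gdload_linear m a u v :
  gdload m (a *: u + v) = a * gdload m u + gdload m v.
Proof.
rewrite /gdload Bsigma_linearr (mpair_linearr (F := fun v => gdPi D v))//.
  by ring.
by move=> w; exact/mintegrableC/mintegrable_transport_lift.
Qed.

(** The difference of the two sides is the noise form at [(m' - m, m' - m)].  Hence
the noise cancels when two solutions with the same increment are compared. *)
Lemma gdload_skew m m' : gdload m' (m' - m) = gdload m (m' - m).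
Proof.
rewrite /gdload; congr (_ + _).
rewrite -{1}[m'](subrK m) -{1}[m' - m]scale1r Bsigma_linearl Bsigma_skew.
by rewrite mulr0 add0r.
Qed.

Lemma gdstress_monotone m m' : 0 <= gdstress m' (m' - m) - gdstress m (m' - m).
Proof.
rewrite /gdstress -mpairBl; try exact: mintegrable_stress.
apply: Rintegral_ge0 => x _.
set A := gdeps D m' x + _; set B := gdeps D m x + _.
rewrite (_ : gdeps D (m' - m) x = A - B); first exact: Sp_monotone.
by rewrite /A /B linearB opprD addrACA subrr addr0.
Qed.

(** The smaller of [p] and its dual exponent is conjugate to the other one. *)
Lemma Lfun_chi_div q v : (fun x => gdchi D q x * gddiv D v x) \in Lfun mu 1.
Proof.
have := gdchiP q; have [pp'|p'p] := leP p p' => qL.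
  exact: (Lfun_mul (lt_trans ltr01 p_gt1) (lt_trans ltr01 p'_gt1) conj_p qL
    (gddivP v p'_in)).
have conj_p' : p'^-1 + p^-1 = 1 by rewrite addrC.
exact: (Lfun_mul (lt_trans ltr01 p'_gt1) (lt_trans ltr01 p_gt1) conj_p' qL
  (gddivP v p_in)).
Qed.

Lemma gdE0_linear a (u v : gdX D) : gdE0 u -> gdE0 v -> gdE0 (a *: u + v).
Proof.
move=> Eu Ev q Yq.
have Iu := (Lfun1_integrable mu _).1 (Lfun_chi_div q u).
have Iv := (Lfun1_integrable mu _).1 (Lfun_chi_div q v).
transitivity (a * spair mu (gdchi D q) (gddiv D u) +
  spair mu (gdchi D q) (gddiv D v)); last by rewrite Eu// Ev// mulr0 addr0.
rewrite /spair -RintegralZl// -RintegralD//.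
  by apply: eq_Rintegral => x _; rewrite linE1; ring.
by apply: eq_integrable (integrableZl _ a Iu).
Qed.

Lemma gdE0_0 : gdE0 (0 : gdX D).
Proof.
move=> q _; rewrite /spair linear0.
under eq_Rintegral do rewrite mulr0.
by rewrite /Rintegral integral0.
Qed.

Lemma gdE0_B (u v : gdX D) : gdE0 u -> gdE0 v -> gdE0 (u - v).
Proof. by move=> Eu Ev; rewrite addrC -scaleN1r; exact: gdE0_linear. Qed.

Lemma gdE0_midpoint (u v : gdX D) : gdE0 u -> gdE0 v -> gdE0 (midpoint u v).
Proof.
move=> Eu Ev; rewrite /midpoint -[_ *: _]addr0.
apply: gdE0_linear; last exact: gdE0_0.
by rewrite -[v]scale1r; exact: gdE0_linear.
Qed.

(** The function reconstruction is one-to-one on discretely divergence-free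
fields. *)
Lemma gdform_definite v : gdE0 v -> gdform v v = 0 -> v = 0.
Proof.
move=> Ev v0; apply: gdPi_inj => //; first exact: gdE0_0.
have I := mintegrable_Pi v v.
have : (\int[mu]_x `|(mxdot (gdPi D v x) (gdPi D v x))%:E| = 0)%E.
  have Ifin := integrable_fin_num measurableT I.
  have I0 : (\int[mu]_x (mxdot (gdPi D v x) (gdPi D v x))%:E = 0)%E.
    by rewrite -[LHS](fineK Ifin); congr EFin; exact: v0.
  by rewrite -[RHS]I0; apply: eq_integral => x _; rewrite gee0_abs// lee_fin mxdot_ge0.
have /integrableP[mI _] := I.
move/(ae_eq_integral_abs mu measurableT mI); apply: filterS => x /(_ Logic.I).
rewrite /= => -[x0]; rewrite linear0; apply: enorm_eq0.
by apply/eqP; rewrite -sqrf_eq0 enorm_sqr x0.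
Qed.

(** The time step with the pressure eliminated. *)
Definition reduced_step (v : gdX D) (w : R) (v' : gdX D) :=
  [/\ gdE0 v, gdE0 v' & forall xi, gdE0 xi ->
    gdform (v' - v) xi + tau * gdstress (midpoint v v') xi =
    gdload (midpoint v v') xi * w].

(** Differences of pressures integrate to zero against discrete divergences of
the divergence-free test fields. *)
Lemma gd_step_reduced w v pi v' pi' : gdE0 v -> gdY0 pi -> gdY0 pi' ->
  gd_step kappa tau g sigma w v pi v' pi' -> reduced_step v w v'.
Proof.
move=> Ev Ypi Ypi' step.
have Y00 : gdY0 (0 : gdY D).
  rewrite /gdY0/= linear0; by rewrite /Rintegral integral0.
have Em : gdE0 (midpoint v v').
  by move=> q Yq; rewrite -[RHS](step 0 q Yq).2; apply: eq_Rintegral => x _;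
    rewrite mulrC.
have Ev' : gdE0 v'.
  rewrite (_ : v' = 2 *: midpoint v v' + -1 *: v).
    apply: gdE0_linear => //.
    by rewrite -[_ *: v]addr0; apply: gdE0_linear => //; exact: gdE0_0.
  by rewrite /midpoint scalerA divff// scale1r scaleN1r addrK.
split=> // xi Exi; have [+ _] := step xi 0 Y00.
rewrite (_ : spair _ _ _ = 0) ?subr0; last first.
  have I q := (Lfun1_integrable mu _).1 (Lfun_chi_div q xi).
  transitivity (spair mu (gdchi D pi') (gddiv D xi) -
                spair mu (gdchi D pi) (gddiv D xi)).
    rewrite /spair -RintegralB//.
    by apply: eq_Rintegral => x _; rewrite mulrBl.
  by rewrite Exi// Exi// subrr.
rewrite -/(gdstress _ _) -/(gdload _ _) => <-; congr (_ + _).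
by congr mpair; apply/funext => x; rewrite linearB.
Qed.

(** Let [V] and [V'] be the differences of the old and of the new velocities, and
test the difference of the two equations with the difference [dm] of the
midpoints.  The form at [(V' - V, dm)] is half the left-hand side because [dm]
is half the sum of [V] and [V'], the stresses contribute a nonnegative term, and
by skewness the load of the first solution may be replaced by that of the
second, which leaves only the difference of the increments. *)
Lemma reduced_step_energy v1 w1 v1' v2 w2 v2' :
  reduced_step v1 w1 v1' -> reduced_step v2 w2 v2' ->
  gdform (v2' - v1') (v2' - v1') - gdform (v2 - v1) (v2 - v1) <=
  2 * (gdload (midpoint v2 v2') (midpoint v2 v2' - midpoint v1 v1') *
       (w2 - w1)).
Proof.
move=> [E1 E1' s1] [E2 E2' s2].
set m1 := midpoint v1 v1' in s1 *; set m2 := midpoint v2 v2' in s2 *.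
set dm := m2 - m1.
have Edm : gdE0 dm by apply: gdE0_B; exact: gdE0_midpoint.
have := s2 _ Edm; have := s1 _ Edm.
rewrite (gdload_skew m1 m2 : gdload m2 dm = gdload m1 dm) => e1 e2.
have mono : 0 <= tau * (gdstress m2 dm - gdstress m1 dm).
  by rewrite mulr_ge0 ?(ltW tau_gt0)//; exact: gdstress_monotone.
have VE V V' : gdform V' V' - gdform V V =
    2 * gdform (V' - V) (2^-1 *: V' + 2^-1 *: V).
  rewrite gdformB ![gdform _ (_ + _)]gdformC !gdformD !gdformZ [gdform V V']gdformC.
  by field.
have dmE : dm = 2^-1 *: (v2' - v1') + 2^-1 *: (v2 - v1).
  rewrite /dm /m1 /m2 /midpoint -scalerBr -scalerDr; congr (_ *: _).
  by rewrite opprD addrACA.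
have : gdform ((v2' - v1') - (v2 - v1)) dm =
    gdform (v2' - v2) dm - gdform (v1' - v1) dm.
  rewrite -gdformB; congr gdform.
  by rewrite !opprB addrACA [RHS]addrACA; congr (_ + _); rewrite addrC.
rewrite VE -dmE; lra.
Qed.

Lemma gd_initialE (vin : L2) v pi : gd_initial vin v pi ->
  gdE0 v /\ forall xi, gdE0 xi -> gdform v xi = mpair mu vin (gdPi D xi).
Proof.
move=> [Ypi eqv divv]; split=> [q Yq|xi Exi].
  by rewrite -[RHS](divv _ Yq); apply: eq_Rintegral => x _; rewrite mulrC.
by have := eqv xi; rewrite Exi// addr0.
Qed.

End scheme.

(** * The Wiener increments and the distance of the space L2 *)

(** The common law is introduced as the image measure of the first increment; all
increments over time steps of equal length have the same normal law. *)
Lemma Wiener_fresh_noise (R : realType) dOm (Omega : measurableType dOm)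
    (P : probability Omega R) F W (tau : R) : 0 < tau ->
  usual_filtration P F -> Wiener_process P F W ->
  exists nu, fresh_noise P nu (fun n => F (n%:R * tau))
    (fun n => increment W (n%:R * tau) (n.+1%:R * tau)).
Proof.
move=> tau0 [sF Fmono negF _] [Wad _ _ Wind Wlaw].
have t0 n : 0 <= n%:R * tau by rewrite mulr_ge0// ltW.
have tlt n : n%:R * tau < n.+1%:R * tau by rewrite ltr_pM2r// ltr_nat.
have tauE n : n.+1%:R * tau - n%:R * tau = tau.
  by rewrite -mulrBl -natrB// subSnn mul1r.
have cF n : complete_subalgebra P (F (n%:R * tau)).
  have [sn mn] := sF _ (t0 n); split=> // A /negF; exact: Fmono.
have ad n : adapted (F (n.+1%:R * tau))
    (increment W (n%:R * tau) (n.+1%:R * tau)).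
  have Wn t : 0 <= t -> t <= n.+1%:R * tau -> adapted (F (n.+1%:R * tau)) (W t).
    by move=> t_ge0 tn B mB; apply: (Fmono t) => //; exact: Wad.
  apply/(adaptedP (cF n.+1)); apply: measurable_funB.
    by apply/(adaptedP (cF n.+1)); exact: Wn.
  by apply/(adaptedP (cF n.+1)); apply: Wn => //; exact: ltW.
have m0 := adapted_measurable (cF 1%N) (ad 0%N).
pose X0 : {RV P >-> R} :=
  MeasurableFun.Pack (MeasurableFun.Class (isMeasurableFun.Build _ _ _ _ _ m0)).
exists (distribution P X0); split=> // [n|n A B FA mB]; first exact/Fmono/ltW.
rewrite (Wind _ _ _ _ (t0 n) (tlt n) FA mB) (Wlaw _ _ _ (t0 n) (tlt n) mB).
congr (_ * _)%E; rewrite tauE -{1}(tauE 0%N).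
by rewrite -(Wlaw _ _ _ (t0 0%N) (tlt 0%N) mB).
Qed.

Section L2_distance.
Context d (T : measurableType d) (R : realType).
Variables (mu : {measure set T -> \bar R}) (n : nat).

Lemma L2dist_ge0 (u v : L2field mu n) : 0 <= L2dist u v.
Proof. by apply: fine_ge0; exact: Lnorm_ge0. Qed.

Lemma mintegrable_L2field (u v : L2field mu n) : mintegrable mu u v.
Proof.
apply: (mintegrable_Lp (p := 2) (q := 2)); rewrite ?ltr1n//; try exact: L2funP.
by field.
Qed.

Lemma mintegrable_L2B (u v w : L2field mu n) :
  mintegrable mu (fun x => u x - v x) w.
Proof.
rewrite (_ : (fun x => _) = fun x => u x + (-1) *: v x).
  apply: mintegrableDl; first exact: mintegrable_L2field.
  exact/mintegrableZl/mintegrable_L2field.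
by apply/funext => x; rewrite scaleN1r.
Qed.

Lemma mintegrable_L2BB (u v : L2field mu n) :
  mintegrable mu (fun x => u x - v x) (fun x => u x - v x).
Proof.
rewrite [X in mintegrable _ X _](_ : _ = fun x => u x + (-1) *: v x).
  apply: mintegrableDl; first exact/mintegrableC/mintegrable_L2B.
  exact/mintegrableZl/mintegrableC/mintegrable_L2B.
by apply/funext => x; rewrite scaleN1r.
Qed.

Lemma L2dist_sqr (u v : L2field mu n) :
  L2dist u v ^+ 2 = mpair mu (fun x => u x - v x) (fun x => u x - v x).
Proof.
set w := fun x => u x - v x.
have I : mintegrable mu w w by exact: mintegrable_L2BB.
have NE : (Lp_norm mu 2%:E w `^ 2 = (mpair mu w w)%:E)%E.
  rewrite /Lp_norm poweR_Lnorm// /mpair /Rintegral fineK//; last first.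
    exact: integrable_fin_num.
  apply: eq_integral => x _ /=; rewrite ger0_norm ?enorm_ge0//.
  by rewrite powR_mulrn ?enorm_ge0// enorm_sqr.
have Nfin : Lp_norm mu 2%:E w \is a fin_num.
  rewrite ge0_fin_numE ?Lnorm_ge0//; apply: (@lty_poweRy _ _ 2) => //.
  by rewrite NE ltry.
rewrite /L2dist -/w -powR_mulrn ?fine_ge0 ?Lnorm_ge0//.
by apply: EFin_inj; rewrite -poweR_EFin fineK.
Qed.

End L2_distance.

(** * The time step in orthonormal coordinates *)

Section coordinates.
Variables (R : realType) (d : nat) (O : polygonal_domain R d) (p kappa tau : R).
Variables (g sigma : 'rV[R]_d -> 'rV[R]_d) (D : gradDisc O p).
Hypotheses (p_gt1 : 1 < p) (kappa_ge0 : 0 <= kappa) (tau_gt0 : 0 < tau).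
Hypotheses (gW : Sobolev_field O 2 +oo g) (sigmaW : Sobolev_field O 1 +oo sigma).
Local Notation mu := (dx O).
Local Notation L2 := (L2field mu d).
Variables (k : nat) (e : 'I_k -> gdX D).
Hypothesis oe : orthonormal_family (@gdE0 _ _ _ _ D) (@gdform _ _ _ _ D) e.
Hypothesis e_span : forall v : gdX D, gdE0 v -> v = \sum_i gdform v (e i) *: e i.
Local Notation H := 'rV[R]_k.

Definition gdlift (x : H) : gdX D := \sum_i x ord0 i *: e i.

Definition gdcoord (v : gdX D) : H := \row_i gdform v (e i).

Lemma gdlift_E0 x : gdE0 (gdlift x).
Proof.
apply: span_mem; [exact: gdE0_linear|exact: gdE0_0|exact: oe.1].
Qed.

Lemma gdcoordK v : gdE0 v -> gdlift (gdcoord v) = v.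
Proof.
by move=> Ev; rewrite [RHS]e_span//; apply: eq_bigr => i _; rewrite mxE.
Qed.

Lemma gdlift_linear a x y : gdlift (a *: x + y) = a *: gdlift x + gdlift y.
Proof.
rewrite /gdlift scaler_sumr -big_split; apply: eq_bigr => i _ /=.
by rewrite !mxE scalerDl scalerA.
Qed.

Lemma gdliftB x y : gdlift (x - y) = gdlift x - gdlift y.
Proof. by rewrite addrC -scaleN1r gdlift_linear scaleN1r addrC. Qed.

Lemma gdform_lift v x : gdform v (gdlift x) = \sum_i x ord0 i * gdform v (e i).
Proof.
rewrite gdformC (@linear_form_sum _ _ (fun u => gdform u v)); last first.
  by move=> *; exact: gdform_linear.
by apply: eq_bigr => i _; rewrite gdformC.
Qed.

Lemma gdliftK x : gdcoord (gdlift x) = x.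
Proof.
apply/rowP => i; rewrite mxE.
exact: (orthonormal_coord (@gdform_linear _ _ _ _ _) (fun i => x ord0 i) i oe).
Qed.

Lemma gdform_lift2 x y : gdform (gdlift x) (gdlift y) = mxdot x y.
Proof.
rewrite gdform_lift /mxdot big_ord1; apply: eq_bigr => i _.
by rewrite mulrC -{2}[x]gdliftK mxE.
Qed.

Lemma enorm_gdlift x : gdform (gdlift x) (gdlift x) = enorm x ^+ 2.
Proof. by rewrite gdform_lift2 enorm_sqr. Qed.

Lemma L2dist_PiL2 (u v : gdX D) :
  L2dist (PiL2 u) (PiL2 v) ^+ 2 = gdform (u - v) (u - v).
Proof. by rewrite L2dist_sqr /gdform linearB. Qed.

Lemma L2dist_gdlift x y :
  L2dist (PiL2 (gdlift x)) (PiL2 (gdlift y)) = enorm (x - y).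
Proof.
apply/eqP; rewrite -(@eqrXn2 _ 2)// ?L2dist_ge0 ?enorm_ge0//.
by rewrite L2dist_PiL2 -gdliftB enorm_gdlift.
Qed.

Definition coord_step (x : H) (w : R) (x' : H) :=
  reduced_step kappa tau g sigma (gdlift x) w (gdlift x').

(** A bound for the norm of the load as a linear form on the test fields: its
values at the basis vectors, summed. *)
Definition noise_gain (x x' : H) : R :=
  \sum_i `|gdload g sigma (midpoint (gdlift x) (gdlift x')) (e i)|.

Lemma noise_gain_ge0 x x' : 0 <= noise_gain x x'.
Proof. by apply: sumr_ge0. Qed.

(** In the energy estimate the difference of the squared norms factors, and the
difference of the midpoints is at most half the sum of the norms, so one factor
cancels. *)
Lemma coord_step_stable x1 w1 x1' x2 w2 x2' :
  coord_step x1 w1 x1' -> coord_step x2 w2 x2' ->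
  enorm (x2' - x1') <= enorm (x2 - x1) + noise_gain x2 x2' * `|w2 - w1|.
Proof.
move=> s1 s2.
have := reduced_step_energy p_gt1 kappa_ge0 tau_gt0 gW sigmaW s1 s2.
rewrite -!gdliftB !enorm_gdlift.
set m2 := midpoint (gdlift x2) (gdlift x2').
set V' := enorm (x2' - x1'); set V := enorm (x2 - x1); set dw := w2 - w1.
pose z := 2^-1 *: (x2' - x1') + 2^-1 *: (x2 - x1).
have zE : m2 - midpoint (gdlift x1) (gdlift x1') = gdlift z.
  rewrite /m2 /midpoint /z -scalerBr -scalerDr.
  rewrite -[2^-1 *: (_ + _ : H)]addr0 gdlift_linear.
  have -> : gdlift 0 = 0 by rewrite -(subrr 0) gdliftB subrr.
  rewrite addr0 -[x2' - x1' + _]/(_ + _) -[x2' - x1']scale1r gdlift_linear.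
  by rewrite scale1r !gdliftB opprD addrACA.
have zV : enorm z <= (V' + V) / 2.
  apply: le_trans (enormD _ _) _; rewrite !enorm_scale ger0_norm ?invr_ge0//.
  by rewrite -/V -/V'; lra.
have load : `|gdload g sigma m2 (gdlift z)| <= noise_gain x2 x2' * enorm z.
  rewrite linear_form_sum; last by move=> *; exact: gdload_linear.
  apply: le_trans (ler_norm_sum _ _ _) _; rewrite mulr_suml.
  apply: ler_sum => i _; rewrite normrM mulrC ler_wpM2l//.
  exact: ler_entry_enorm.
rewrite zE => energy.
set Kg := noise_gain x2 x2' in load *.
have K0 : 0 <= Kg := noise_gain_ge0 _ _.
have V0 : 0 <= V := enorm_ge0 _; have V'0 : 0 <= V' := enorm_ge0 _.
have dw0 : 0 <= `|dw| by [].
have bound : V' ^+ 2 - V ^+ 2 <= (V' + V) * (Kg * `|dw|).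
  apply: (le_trans energy); rewrite mulrC -ler_pdivlMr//.
  apply: le_trans (ler_norm _) _; rewrite normrM.
  apply: (@le_trans _ _ (Kg * ((V' + V) / 2) * `|dw|)).
    rewrite ler_wpM2r//; apply: (le_trans load); exact: ler_wpM2l.
  by rewrite le_eqVlt; apply/orP; left; apply/eqP; field.
have [S0|S0] := leP (V' + V) 0.
  have : 0 <= Kg * `|dw| by rewrite mulr_ge0.
  by lra.
rewrite -(ler_pM2l S0) -subr_ge0; move: bound; rewrite -subr_ge0.
by congr (0 <= _); ring.
Qed.

End coordinates.

(** * The telescoping estimate *)

Lemma Rintegral_sum d (T : measurableType d) (R : realType)
    (mu : {measure set T -> \bar R}) (f : nat -> T -> R) N :
  (forall l, (l < N)%N -> mu.-integrable setT (EFin \o f l)) ->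
  mu.-integrable setT (EFin \o (fun w => \sum_(0 <= l < N) f l w)) /\
  \int[mu]_w \sum_(0 <= l < N) f l w = \sum_(0 <= l < N) \int[mu]_w f l w.
Proof.
elim: N => [|N IHN] fI.
  rewrite (_ : (fun w => _) = cst 0); last first.
    by apply/funext => w; rewrite big_geq.
  by rewrite big_geq//; split; [exact: integrable0|rewrite /Rintegral integral0].
have [I E] := IHN (fun l lN => fI l (ltnW lN)).
have fN := fI N (ltnSn N).
split.
  apply: eq_integrable (integrableD measurableT I fN) => // w _ /=.
  by rewrite big_nat_recr.
rewrite big_nat_recr//= -E -RintegralD//.
by apply: eq_Rintegral => w _; rewrite big_nat_recr.
Qed.

(** Raising the shift by one adds only the two end terms. *)
Lemma telescope_shift_bound (R : realDomainType) (a : nat -> R) M n N :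
  (forall l, `|a l| <= M) ->
  `|\sum_(0 <= l < N) (a (l + n)%N - a l)| <= 2 * M * n%:R.
Proof.
move=> aM; elim: n => [|n IHn].
  rewrite big1 ?normr0 ?mulr0// => l _; by rewrite addn0 subrr.
have -> : \sum_(0 <= l < N) (a (l + n.+1)%N - a l) =
    \sum_(0 <= l < N) (a (l + n)%N - a l) + (a (N + n)%N - a n).
  rewrite -[a n]/(a (0 + n)%N) -(telescope_sumr (fun l => a (l + n)%N))//.
  rewrite -big_split; apply: eq_bigr => l _ /=.
  by rewrite addnS addSn; ring.
apply: le_trans (ler_normD _ _) _.
have := aM (N + n)%N; have := aM n; have := ler_normB (a (N + n)%N) (a n).
by rewrite -natr1; lra.
Qed.

Section defect.
Context dOm (Omega : measurableType dOm) (R : realType).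
Variables (P : probability Omega R) (k : nat).
Variables (x z : nat -> Omega -> 'rV[R]_k) (h Q : 'rV[R]_k -> R) (M L : R).
Variables (n N : nat).
Hypotheses (N_gt0 : (0 < N)%N) (bh : BLip M L h) (bQ : BLip M L Q).
Hypotheses (mx : forall l, measurable_fun setT (x l))
  (mz : forall l, measurable_fun setT (z l)).
Hypothesis Qh : forall l,
  \int[P]_w Q (x l w) = \int[P]_w h (x (l + n)%N w).

Let gap l w := enorm (z l w - x l w).
Let Y w := N%:R^-1 * \sum_(0 <= l < N) gap l w ^+ 2.

Let mgap l : measurable_fun setT (gap l).
Proof. by apply: measurable_enorm; exact: measurable_mxB. Qed.

Let N0 : 0 < N%:R :> R. Proof. by rewrite ltr0n. Qed.

(** Since [d <= (t + d ^+ 2 / t) / 2] for every [t > 0], the mean distance is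
controlled by the mean square with a free weight [t]. *)
Let defect_weighted s t : P.-integrable setT (EFin \o Y) ->
  \int[P]_w Y w = s -> 0 < t ->
  `|N%:R^-1 * \sum_(0 <= l < N)
     (\int[P]_w Q (z l w) - \int[P]_w h (z l w))| <=
  2 * M * (n%:R / N%:R) + 2 * L * ((t + s / t) / 2).
Proof.
move=> IY Ys t0; have [L0 hM _] := bh.
have gapI l : (l < N)%N -> P.-integrable setT (EFin \o (fun w => gap l w ^+ 2)).
  move=> lN; apply: le_integrable (integrableZl measurableT N%:R IY) => //.
    by apply/measurable_EFinP; exact: measurable_funX.
  move=> w _; rewrite /= lee_fin [leRHS]ger0_norm; last first.
    rewrite mulr_ge0// /Y mulr_ge0 ?invr_ge0// sumr_ge0// => i _.
    exact: sqr_ge0.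
  rewrite ger0_norm ?sqr_ge0// /Y mulrA divff ?gt_eqF// mul1r big_mkord.
  rewrite (bigD1 (Ordinal lN))//= lerDl sumr_ge0// => i _; exact: sqr_ge0.
pose s_ l := \int[P]_w (gap l w ^+ 2).
have sE : s = N%:R^-1 * \sum_(0 <= l < N) s_ l.
  have [I <-] := Rintegral_sum gapI.
  by rewrite -Ys /Y RintegralZl.
have close f l : (l < N)%N -> BLip M L f ->
    `|\int[P]_w f (z l w) - \int[P]_w f (x l w)| <= L * ((t + s_ l / t) / 2).
  move=> lN bf; have [_ fM fL] := bf.
  have mf := measurable_BLip bf.
  have I (y : nat -> Omega -> 'rV[R]_k) : (forall l, measurable_fun setT (y l)) ->
      P.-integrable setT (EFin \o (fun w => f (y l w))).
    move=> my; apply: (@bounded_integrable _ _ _ _ _ M) => //.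
    exact: (measurableT_comp mf).
  rewrite -RintegralB//; [|exact: I|exact: I].
  apply: le_trans (le_normr_Rintegral _ _) _ => //.
    by apply: eq_integrable (integrableB measurableT (I _ mz) (I _ mx)).
  have Ig : P.-integrable setT (EFin \o (fun w => t + t^-1 * gap l w ^+ 2)).
    apply: eq_integrable (integrableD measurableT
      (finite_measure_integrable_cst P t measurableT)
      (integrableZl measurableT t^-1 (gapI l lN))) => //.
  have -> : L * ((t + s_ l / t) / 2) =
      \int[P]_w (L / 2 * (t + t^-1 * gap l w ^+ 2)).
    rewrite RintegralZl// RintegralD//; last 2 first.
      exact: finite_measure_integrable_cst.
      exact: (integrableZl measurableT t^-1 (gapI l lN)).
    rewrite RintegralZl//; last exact: gapI.
    by rewrite Rintegral_prob_cst /s_; field; rewrite gt_eqF.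
  apply: le_Rintegral => //.
  - apply: integrable_norm => //.
    by apply: eq_integrable (integrableB measurableT (I _ mz) (I _ mx)).
  - exact: (integrableZl measurableT (L / 2) Ig).
  move=> w _; apply: (le_trans (fL _ _)).
  rewrite -mulrA ler_wpM2l// -/(gap l w).
  have : 0 <= (t - gap l w) ^+ 2 / t by rewrite divr_ge0 ?sqr_ge0// ltW.
  rewrite (_ : (t - gap l w) ^+ 2 / t =
    t + t^-1 * gap l w ^+ 2 - 2 * gap l w); first by lra.
  by field; rewrite gt_eqF.
pose a l := \int[P]_w h (x l w).
have aM l : `|a l| <= M.
  have M0 : 0 <= M := le_trans (normr_ge0 _) (hM 0).
  apply: ae_Rintegral_le => //; last exact: aeW.
  exact: (measurableT_comp (measurable_BLip bh)).
have -> : \sum_(0 <= l < N) (\int[P]_w Q (z l w) - \int[P]_w h (z l w)) =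
    \sum_(0 <= l < N) (\int[P]_w Q (z l w) - \int[P]_w Q (x l w)) +
    \sum_(0 <= l < N) (a (l + n)%N - a l) -
    \sum_(0 <= l < N) (\int[P]_w h (z l w) - a l).
  rewrite -big_split -sumrB; apply: eq_bigr => l _ /=.
  by rewrite Qh -/(a _); ring.
have sum_close f : BLip M L f ->
    `|\sum_(0 <= l < N) (\int[P]_w f (z l w) - \int[P]_w f (x l w))| <=
    N%:R * (L * ((t + s / t) / 2)).
  move=> bf; apply: le_trans (ler_norm_sum _ _ _) _.
  apply: (@le_trans _ _ (\sum_(0 <= l < N) L * ((t + s_ l / t) / 2))).
    by rewrite !big_nat; apply: ler_sum => l /andP[_ lN]; exact: close.
  rewrite le_eqVlt; apply/orP; left; apply/eqP.
  rewrite -mulr_sumr -mulr_suml big_split/= -mulr_suml.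
  rewrite sumr_const_nat subn0 -mulr_natl sE.
  by field; rewrite !gt_eqF.
have tele := telescope_shift_bound n N aM.
rewrite normrM (_ : `|N%:R^-1| = N%:R^-1); last by rewrite ger0_norm// invr_ge0.
rewrite [leLHS]mulrC ler_pdivrMr//.
apply: le_trans (ler_normB _ _) _.
apply: le_trans (lerD (ler_normD _ _) (lexx _)) _.
apply: le_trans (lerD (lerD (sum_close _ bQ) tele) (sum_close _ bh)) _.
by rewrite le_eqVlt; apply/orP; left; apply/eqP; field; rewrite !gt_eqF.
Qed.

(** The optimal weight is the root mean square itself; if it vanishes, the weight
tends to zero. *)
Lemma midpoint_defect :
  (`|(N%:R^-1 * \sum_(0 <= l < N)
     (\int[P]_w Q (z l w) - \int[P]_w h (z l w)))%:E| <=
  (2 * M + 2 * L + 1)%:E * ((n%:R / N%:R)%:E + sqrte (\int[P]_w (Y w)%:E)))%E.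
Proof.
have [L0 hM _] := bh; have M0 : 0 <= M := le_trans (normr_ge0 _) (hM 0).
have C0 : 0 < 2 * M + 2 * L + 1 by lra.
have Y0 w : 0 <= Y w.
  by rewrite mulr_ge0 ?invr_ge0// sumr_ge0// => i _; exact: sqr_ge0.
have mY : measurable_fun setT Y.
  apply: measurable_funM => //; apply: measurable_sum => l.
  exact: measurable_funX.
have IY0 : (0 <= \int[P]_w (Y w)%:E)%E.
  by apply: integral_ge0 => w _; rewrite lee_fin.
have [Yoo|Yfin] := eqVneq (\int[P]_w (Y w)%:E)%E +oo%E.
  by rewrite Yoo /= addey// mulry gtr0_sg// mul1e leey.
have IY : P.-integrable setT (EFin \o Y).
  apply/integrableP; split; first exact/measurable_EFinP.
  under eq_integral do rewrite /= ger0_norm//.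
  by rewrite ltey.
set s := \int[P]_w Y w.
have sE : (\int[P]_w (Y w)%:E = s%:E)%E by rewrite fineK// integrable_fin_num.
have s0 : 0 <= s by rewrite -lee_fin -sE.
rewrite sE /= -EFinD -EFinM lee_fin.
have bnd t : 0 < t -> `|N%:R^-1 * \sum_(0 <= l < N)
     (\int[P]_w Q (z l w) - \int[P]_w h (z l w))| <=
    2 * M * (n%:R / N%:R) + 2 * L * ((t + s / t) / 2).
  exact: defect_weighted.
set A := `|_| in bnd *.
have nN : 0 <= n%:R / N%:R :> R by rewrite divr_ge0.
have r0 : 0 <= Num.sqrt s := sqrtr_ge0 s.
apply: (@le_trans _ _ (2 * M * (n%:R / N%:R) + 2 * L * Num.sqrt s)); last first.
  by rewrite mulrDr lerD// ler_wpM2r//; lra.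
have [s_gt0|s_le0] := ltP 0 s.
  have rs0 : 0 < Num.sqrt s by rewrite sqrtr_gt0.
  apply: le_trans (bnd _ rs0) _.
  rewrite -{2}[s]sqr_sqrtr// le_eqVlt; apply/orP; left; apply/eqP.
  by field; rewrite !gt_eqF.
have {s_le0}s00 : s = 0 by apply/eqP; rewrite eq_le s_le0.
rewrite s00 sqrtr0 mulr0; apply/ler_addgt0Pr => eps eps0.
have t0 : 0 < eps / (L + 1) by rewrite divr_gt0// ltr_wpDl.
apply: le_trans (bnd _ t0) _; rewrite s00 mul0r !addr0 lerD2l.
have L1 : 0 < L + 1 by rewrite ltr_wpDl.
have -> : 2 * L * (eps / (L + 1) / 2) = eps * (L / (L + 1)).
  by field; rewrite gt_eqF.
rewrite ler_piMr// ?(ltW eps0)// ler_pdivrMr// mul1r lerDl//.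
Qed.

End defect.

(** * Integrals against the empirical measure *)

Section empirical.
Context dOm (Omega : measurableType dOm) d (T : measurableType d) (R : realType).
Variables (P : probability Omega R) (X : nat -> Omega -> T) (N : nat).
Hypothesis mX : forall l, measurable_fun setT (X l).

Definition empirical (A : set T) : \bar R :=
  ((N%:R^-1)%:E * \sum_(0 <= l < N) P [set w | A (X l w)])%E.

Let Z l : {RV P >-> T} :=
  MeasurableFun.Pack (MeasurableFun.Class (isMeasurableFun.Build _ _ _ _ _ (mX l))).

Let N0 : 0 <= N%:R^-1 :> R. Proof. by rewrite invr_ge0. Qed.

Let nu : {measure set T -> \bar R} :=
  mscale (NngNum N0) (msum (fun l => distribution P (Z l)) N).

Let empiricalE : empirical = nu.
Proof. by apply/funext => A; rewrite /empirical big_mkord. Qed.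

Let ge0_integral_empirical (f : T -> R) M : measurable_fun setT f ->
  (forall v, 0 <= f v <= M) ->
  (\int[nu]_v (f v)%:E =
   (N%:R^-1 * \sum_(0 <= l < N) \int[P]_w f (X l w))%:E)%E.
Proof.
move=> mf fM.
have f0 v : (0 <= (f v)%:E)%E by rewrite lee_fin; have /andP[] := fM v.
have mfE : measurable_fun setT (fun v => (f v)%:E) by exact/measurable_EFinP.
rewrite ge0_integral_mscale// ge0_integral_measure_sum//= EFinM; congr (_ * _)%E.
rewrite big_mkord -sumEFin; apply: eq_bigr => l _.
rewrite ge0_integral_distribution// /Rintegral fineK//.
apply: integrable_fin_num => //; apply: (@bounded_integrable _ _ _ _ _ M) => [|w].
  exact: (measurableT_comp mf).
by rewrite ger0_norm; have /andP[] := fM (X l w).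
Qed.

(** The integral with respect to [empirical] makes sense because this set function
coincides, on all sets, with a scaled sum of image measures. *)
Lemma integral_empirical (f : T -> R) M : measurable_fun setT f ->
  (forall v, `|f v| <= M) ->
  (\int[empirical]_v (f v)%:E =
   (N%:R^-1 * \sum_(0 <= l < N) \int[P]_w f (X l w))%:E)%E.
Proof.
move=> mf fM; pose fp v := Num.max (f v) 0; pose fn v := Num.max (- f v) 0.
have [mp mn] : measurable_fun setT fp /\ measurable_fun setT fn.
  split; first exact: measurable_maxr.
  by apply: measurable_maxr => //; exact: measurableT_comp.
have pM v : 0 <= fp v <= M.
  rewrite le_max lexx orbT ge_max (le_trans (ler_norm _) (fM v)).
  by rewrite (le_trans (normr_ge0 _) (fM v)).
have nM v : 0 <= fn v <= M.
  rewrite le_max lexx orbT ge_max (le_trans (normr_ge0 _) (fM v)) andbT.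
  by rewrite (le_trans _ (fM v))// -normrN ler_norm.
rewrite empiricalE integralE.
rewrite [X in (X - _)%E](_ : _ = \int[nu]_v (fp v)%:E)%E; last first.
  by apply: eq_integral => v _; rewrite funeposE EFin_max.
rewrite [X in (_ - X)%E](_ : _ = \int[nu]_v (fn v)%:E)%E; last first.
  by apply: eq_integral => v _; rewrite funenegE EFin_max.
rewrite (ge0_integral_empirical mp pM) (ge0_integral_empirical mn nM).
rewrite -EFinB -mulrBr -sumrB; congr (_ * _)%:E; apply: eq_bigr => l _.
have I (u : T -> R) : measurable_fun setT u -> (forall v, 0 <= u v <= M) ->
    P.-integrable setT (EFin \o (fun w => u (X l w))).
  move=> mu uM; apply: (@bounded_integrable _ _ _ _ _ M) => [|w].
    exact: (measurableT_comp mu).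
  by rewrite ger0_norm; have /andP[] := uM (X l w).
rewrite -RintegralB//; [|exact: I|exact: I].
apply: eq_Rintegral => w _; rewrite /fp /fn maxEle maxEle.
by case: ifPn; case: ifPn; lra.
Qed.

End empirical.

Section L2field_borel.
Context d (T : measurableType d) (R : realType).
Variables (mu : {measure set T -> \bar R}) (n : nat).

Lemma open_L2dist (U : set (L2field mu n)) :
  (forall v, U v -> exists2 r : R, 0 < r & forall u, L2dist v u < r -> U u) ->
  open U.
Proof.
move=> Uball; rewrite openE => v /Uball[r r0 rU]; apply/nbhs_ballP.
by exists r.
Qed.

Lemma measurable_L2_Lipschitz (f : L2field mu n -> R) (L : R) : 0 <= L ->
  (forall u v, `|f u - f v| <= L * L2dist u v) -> measurable_fun setT f.
Proof.
move=> L0 fL.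
apply: (measurability _ (RGenOInfty.measurableE R)) => _ [_ [a ->] <-].
rewrite setTI; apply: sub_sigma_algebra; apply: open_L2dist => v.
rewrite /= in_itv/= andbT => av; have L1 : 0 < L + 1 by rewrite ltr_wpDl.
exists ((f v - a) / (L + 1)); first by rewrite divr_gt0// subr_gt0.
move=> u; rewrite ltr_pdivlMr// => vu; rewrite /= in_itv/= andbT.
have := fL v u; rewrite ler_norml => /andP[_ fvu].
by have := L2dist_ge0 v u; lra.
Qed.

Lemma measurable_L2_isometry k (F : 'rV[R]_k -> L2field mu n) :
  (forall x y, L2dist (F x) (F y) = enorm (x - y)) -> measurable_fun setT F.
Proof.
move=> FE; apply: (measurability (rT := L2field mu n) _ erefl) => _ [U oU <-].
rewrite setTI; apply: open_measurable_mx; apply: open_enorm => x UFx.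
have /nbhs_ballP[r r0 rU] : nbhs (F x) U by exact: open_nbhs_nbhs.
by exists r => // y xy; apply: rU; rewrite /ball/= FE.
Qed.

End L2field_borel.

(** * Solutions of the scheme as Markov chains *)

Section solutions.
Variables (R : realType) (d : nat) (O : polygonal_domain R d) (p kappa tau : R).
Variables (g sigma : 'rV[R]_d -> 'rV[R]_d) (D : gradDisc O p).
Hypotheses (p_gt1 : 1 < p) (kappa_ge0 : 0 <= kappa) (tau_gt0 : 0 < tau).
Hypotheses (gW : Sobolev_field O 2 +oo g) (sigmaW : Sobolev_field O 1 +oo sigma).
Variables (dOm : measure_display) (Omega : measurableType dOm).
Variables (P : probability Omega R) (W : R -> Omega -> R).
Local Notation mu := (dx O).
Local Notation L2 := (L2field mu d).
Local Notation xi n := (increment W (n%:R * tau) (n.+1%:R * tau)).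

(** The initialisation is an orthogonal projection in [L^2], hence nonexpansive:
expand the squared norm of [(u - u') - Pi (v - v')].  Taking [u = u'] gives
uniqueness, and in particular independence of the sample point. *)
Lemma gd_initial_unique (u u' : L2) (v v' : gdX D) pi pi' :
  gd_initial u v pi -> gd_initial u' v' pi' ->
  gdform (v - v') (v - v') <= L2dist u u' ^+ 2.
Proof.
move=> /(gd_initialE)[Ev vE] /(gd_initialE)[Ev' v'E].
have Ew : gdE0 (v - v') by exact: gdE0_B.
set w := v - v'; pose c x := u x - u' x.
have cw : mintegrable mu c (gdPi D w) := mintegrable_L2B u u' (PiL2 w).
have ww : gdform w w = mpair mu c (gdPi D w).
  rewrite mpairBl; [|exact: (mintegrable_L2field u (PiL2 w))|
    exact: (mintegrable_L2field u' (PiL2 w))].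
  by rewrite -vE// -v'E// -gdformB.
have cc : mintegrable mu c c := mintegrable_L2BB u u'.
have wc := mintegrableC cw; have wI := mintegrable_Pi w w.
pose b x := c x - gdPi D w x.
have bE (u0 : 'rV[R]_d -> 'rV[R]_d) : mintegrable mu c u0 ->
    mintegrable mu (gdPi D w) u0 ->
    mpair mu b u0 = mpair mu c u0 - mpair mu (gdPi D w) u0.
  exact: mpairBl.
have bI (u0 : 'rV[R]_d -> 'rV[R]_d) : mintegrable mu c u0 ->
    mintegrable mu (gdPi D w) u0 -> mintegrable mu u0 b.
  move=> cu wu; rewrite /b (_ : (fun x => _) = fun x => c x + (-1) *: gdPi D w x).
    by apply/mintegrableC/mintegrableDl => //; exact: mintegrableZl.
  by apply/funext => x; rewrite scaleN1r.
have bb : mpair mu b b = mpair mu c c - gdform w w.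
  rewrite (bE b (bI c cc wc) (bI _ cw wI)).
  rewrite (mpairC mu c b) (mpairC mu (gdPi D w) b) (bE c cc wc) (bE _ cw wI).
  by rewrite (mpairC mu (gdPi D w) c) -ww -/(gdform w w); ring.
have : 0 <= mpair mu b b by apply: Rintegral_ge0 => x _; exact: mxdot_ge0.
by rewrite bb L2dist_sqr -/c subr_ge0.
Qed.

Section one_solution.
Variables (vin : L2) (v : nat -> Omega -> gdX D) (pi : nat -> Omega -> gdY D).
Hypothesis sol : gd_solution kappa tau g sigma P W vin v pi.

Let pi_Y0 n w : gdY0 (pi n w).
Proof. by case: n => [|n]; [have [] := sol.1 w|have [] := sol.2 n]. Qed.

Let step_E0 n w : gdE0 (v n w) ->
  gd_step kappa tau g sigma (xi n w) (v n w) (pi n w) (v n.+1 w) (pi n.+1 w) ->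
  reduced_step kappa tau g sigma (v n w) (xi n w) (v n.+1 w).
Proof. by move=> Ev; exact: gd_step_reduced. Qed.

(** The constraint is imposed on midpoints only; it passes from one iterate to the
next because the initial velocity satisfies it. *)
Lemma solution_E0 n : {ae P, forall w, gdE0 (v n w)}.
Proof.
elim: n => [|n IHn].
  by apply: aeW => w; have [] := gd_initialE (sol.1 w).
by apply: filterS2 IHn (sol.2 n).2 => w Ev /(step_E0 Ev)[].
Qed.

Lemma solution_reduced_step n : {ae P, forall w,
  reduced_step kappa tau g sigma (v n w) (xi n w) (v n.+1 w)}.
Proof.
by apply: filterS2 (solution_E0 n) (sol.2 n).2 => w Ev; exact: step_E0.
Qed.

End one_solution.

Variables (k : nat) (e : 'I_k -> gdX D).
Hypothesis oe : orthonormal_family (@gdE0 _ _ _ _ D) (@gdform _ _ _ _ D) e.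
Hypothesis e_span : forall v : gdX D, gdE0 v -> v = \sum_i gdform v (e i) *: e i.
Variable S : nat -> L2 -> Omega -> gdX D.
Hypothesis hS : solution_operator kappa tau g sigma P W S.
Local Notation H := 'rV[R]_k.

Definition coord_chain (u : L2) n w : H := gdcoord e (S n u w).

Definition coord_init (u : L2) : H := coord_chain u 0 point.

Lemma coord_init_unique (u u' : L2) w w' :
  enorm (coord_chain u 0%N w - coord_chain u' 0%N w') <= L2dist u u'.
Proof.
have [pi [sol0 _]] := hS u; have [pi' [sol0' _]] := hS u'.
have [Ev _] := gd_initialE (sol0 w).
have [Ev' _] := gd_initialE (sol0' w').
rewrite -ler_sqr ?nnegrE ?enorm_ge0 ?L2dist_ge0//.
rewrite -(enorm_gdlift oe) gdliftB !(gdcoordK e_span)//.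
exact: gd_initial_unique (sol0 w) (sol0' w').
Qed.

Lemma coord_chainP u : chain P (fun n => xi n)
  (coord_step kappa tau g sigma e) (coord_init u) (coord_chain u).
Proof.
have [pi sol] := hS u; split=> [w|n].
  apply/eqP; rewrite -subr_eq0; apply/eqP; apply: enorm_eq0; apply/eqP.
  rewrite eq_le enorm_ge0 andbT (le_trans (coord_init_unique u u w point))//.
  by rewrite L2distxx.
apply: filterS (solution_reduced_step sol n) => w [Ev Ev' st].
by rewrite /coord_step /coord_chain !(gdcoordK e_span).
Qed.

(** Discretely divergence-free fields are fixed by the initialisation, so a chain
may be restarted from any of its states. *)
Lemma coord_init_gdlift y : coord_init (PiL2 (gdlift e y)) = y.
Proof.
have [pi [sol0 _]] := hS (PiL2 (gdlift e y)).
have [Ev vE] := gd_initialE (sol0 point).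
have El := gdlift_E0 p_gt1 oe y.
rewrite /coord_init /coord_chain -[RHS](gdliftK oe); congr gdcoord.
apply/eqP; rewrite -subr_eq0; apply/eqP; apply: gdform_definite.
  exact: gdE0_B.
have Ew := gdE0_B p_gt1 Ev El; have := vE _ Ew.
rewrite -/(gdform (gdlift e y) _) => eqv.
by rewrite gdformB eqv subrr.
Qed.

Lemma gdcoord_midpoint (u v : gdX D) :
  gdcoord e (midpoint u v) = 2^-1 *: (gdcoord e v + gdcoord e u).
Proof.
apply/rowP => i; rewrite !mxE /midpoint.
by rewrite gdformZ gdformD.
Qed.

End solutions.

(** * The estimate *)

Lemma ae_measurable dOm (Omega : measurableType dOm) (R : realType)
    (P : probability Omega R) d (T : measurableType d) (X Y : Omega -> T) :
  P.-negligible `<=` measurable -> {ae P, forall w, X w = Y w} ->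
  measurable_fun setT X -> measurable_fun setT Y.
Proof.
move=> neg XY mX; have cO : complete_subalgebra P (@measurable _ Omega).
  by split => //; exact: sigma_algebra_measurable.
apply: (adapted_measurable cO); apply: (adapted_ae cO XY) => B mB.
by rewrite -[X in measurable X]setTI; exact: mX.
Qed.

Theorem lemma23
  (R : realType) (d : nat) (hd : (0 < d)%N) (O : polygonal_domain R d)
  (p kappa : R) (hp : 1 < p) (hkappa : 0 <= kappa)
  (dOm : measure_display) (Omega : measurableType dOm) (P : probability Omega R)
  (F : R -> set (set Omega)) (hF : usual_filtration P F)
  (W : R -> Omega -> R) (hW : Wiener_process P F W)
  (g sigma : 'rV[R]_d -> 'rV[R]_d)
  (hg : Winfty_div O 2 g) (hsigma : Winfty_div O 1 sigma)
  (D : gradDisc O p) (Gamma : R) (hGamma : gamma_stable D Gamma)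
  (tau : R) (htau : 0 < tau)
  (S : nat -> L2field (dx O) d -> Omega -> gdX D)
  (hS : solution_operator kappa tau g sigma P W S)
  (vin : L2field (dx O) d) (f : L2field (dx O) d -> R)
  (hfc : continuous f) (hfb : exists M : R, forall u, `|f u| <= M)
  (hfL : exists L : R, forall u v, `|f u - f v| <= L * L2dist u v) :
  exists C : R, forall n N : nat, (0 < n)%N -> (0 < N)%N ->
    (`| \int[mu_half P S N vin]_v (gd_semigroup P S n f v)%:E -
        \int[mu_half P S N vin]_v (f v)%:E | <=
     C%:E * ((n%:R / N%:R)%:E +
       sqrte 'E_P[fun w => (N%:R^-1 * \sum_(0 <= l < N)
         L2dist (PiL2 (half_step S l vin w)) (PiL2 (S l vin w)) ^+ 2)%R]))%E.
Proof.
have gW := hg.1; have sW := hsigma.1.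
have [nu noise] := Wiener_fresh_noise htau hF hW.
(* Almost sure equalities transfer measurability, since the filtration is
   complete. *)
have neg : P.-negligible `<=` @measurable _ Omega.
  have [sF _ nF _] := hF; move=> A /nF; exact: (sF 0 (lexx 0)).2.
have [M fM] := hfb; have [L' fL'] := hfL; pose L := `|L'|.
have L0 : 0 <= L by exact: normr_ge0.
have fL u v : `|f u - f v| <= L * L2dist u v.
  by rewrite (le_trans (fL' u v))// ler_wpM2r ?L2dist_ge0// ler_norm.
have mf : measurable_fun setT f by exact: measurable_L2_Lipschitz fL.
have [k [e [oe e_span]]] := orthonormal_basis
  (gdE0_linear (D := D) hp) (@gdE0_0 _ _ _ _ D) (@gdformC _ _ _ _ D)
  (@gdform_linear _ _ _ _ D) (@gdform_ge0 _ _ _ _ D) (@gdform_definite _ _ _ _ D).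
pose lift y := PiL2 (gdlift e y).
have lift_iso x y : L2dist (lift x) (lift y) = enorm (x - y).
  exact: L2dist_gdlift.
have mlift : measurable_fun setT lift by exact: measurable_L2_isometry lift_iso.
pose h y := f (lift y).
have bh : BLip M L h by split=> // [x|x y]; [exact: fM|rewrite /h -lift_iso].
pose X u := coord_chain e S u.
have chX u : chain P (fun n => increment W (n%:R * tau) (n.+1%:R * tau))
    (coord_step kappa tau g sigma e) (coord_init e S u) (X u).
  exact: coord_chainP.
have chY y : chain P (fun n => increment W (n%:R * tau) (n.+1%:R * tau))
    (coord_step kappa tau g sigma e) y (X (lift y)).
  by have := chX (lift y); rewrite (coord_init_gdlift hp oe hS).
have stable := coord_step_stable hp hkappa htau gW sW oe.
have Kg0 := noise_gain_ge0 g sigma e.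
have mX u l : measurable_fun setT (X u l).
  exact: (chain_measurable noise Kg0 stable l (chX u)).
have E0 u l : {ae P, forall w, gdE0 (S l u w)}.
  by have [pi sol] := hS u; exact: (solution_E0 hp sol l).
have liftK v : gdE0 v -> lift (gdcoord e v) = PiL2 v.
  by move=> Ev; rewrite /lift (gdcoordK e_span).
pose Q n y := \int[P]_w h (X (lift y) n w).
have bQ n : BLip M L (Q n).
  exact: (BLip_semigroup noise Kg0 stable chY n bh).
(* The semigroup sees its argument only through the initialisation. *)
have semiE n u : gd_semigroup P S n f u = Q n (coord_init e S u).
  transitivity (\int[P]_w h (X u n w)).
    rewrite /gd_semigroup expectation.unlock; apply: ae_eq_Rintegral.
    - apply: (ae_measurable neg _ (measurableT_comp (measurable_BLip bh) (mX u n))).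
      by apply: filterS (E0 u n) => w Ew; rewrite /= /h liftK.
    - exact: (measurableT_comp (measurable_BLip bh) (mX u n)).
    - by apply: filterS (E0 u n) => w Ew; rewrite /h liftK.
  rewrite (Rintegral_iter noise Kg0 stable chY n bh (chX u)).
  by rewrite /Q (Rintegral_iter noise Kg0 stable chY n bh (chY _)).
pose z l w := 2^-1 *: (X vin l.+1 w + X vin l w).
have mz l : measurable_fun setT (z l).
  by apply: measurable_mxZ; exact: measurable_mxD.
have halfE l : {ae P, forall w, gdE0 (half_step S l vin w) /\
    gdcoord e (half_step S l vin w) = z l w}.
  apply: filterS2 (E0 vin l) (E0 vin l.+1) => w El El'; split.
    exact: gdE0_midpoint.
  exact: gdcoord_midpoint.
have lift_half l : {ae P, forall w, lift (z l w) = PiL2 (half_step S l vin w)}.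
  by apply: filterS (halfE l) => w [Eh <-]; rewrite liftK.
(* Without this the set function mu_half need not be a measure. *)
have mhalf l : measurable_fun setT (fun w => PiL2 (half_step S l vin w)).
  exact: (ae_measurable neg (lift_half l) (measurableT_comp mlift (mz l))).
have semiL n u v :
    `|gd_semigroup P S n f u - gd_semigroup P S n f v| <= L * L2dist u v.
  rewrite !semiE; have [_ _ QL] := bQ n; apply: (le_trans (QL _ _)).
  by rewrite ler_wpM2l//; exact: (coord_init_unique hp oe e_span hS).
have semiM n u : `|gd_semigroup P S n f u| <= M.
  by rewrite semiE; have [_ QM _] := bQ n; exact: QM.
have msemi n := measurable_L2_Lipschitz L0 (semiL n).
have Q_lift n y : gd_semigroup P S n f (lift y) = Q n y.
  by rewrite semiE (coord_init_gdlift hp oe hS).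
have half_int (phi : L2field (dx O) d -> R) M' : measurable_fun setT phi ->
    (forall u, `|phi u| <= M') -> forall N,
    (\int[mu_half P S N vin]_v (phi v)%:E =
     (N%:R^-1 * \sum_(0 <= l < N) \int[P]_w phi (lift (z l w)))%:E)%E.
  move=> mphi phiM N; rewrite (integral_empirical P N mhalf mphi phiM).
  congr (_ * _)%:E; apply: eq_bigr => l _; apply: ae_eq_Rintegral.
  - exact: (measurableT_comp mphi (mhalf l)).
  - by apply: (measurableT_comp mphi); exact: (measurableT_comp mlift (mz l)).
  - by apply: filterS (lift_half l) => w ->.
exists (2 * M + 2 * L + 1) => n N _ N0.
rewrite (half_int _ _ (msemi n) (semiM n)) (half_int _ _ mf fM).
rewrite -EFinB -mulrBr -sumrB.
under eq_bigr do under eq_Rintegral do rewrite Q_lift.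
have defect := midpoint_defect N0 bh (bQ n) (fun l => mX vin l) mz
  (fun l => markov_property noise Kg0 stable chY l n bh (chX vin)).
apply: (le_trans defect); rewrite le_eqVlt; apply/orP; left; apply/eqP.
congr (_ * (_ + sqrte _))%E; rewrite expectation.unlock.
have distE l : {ae P, forall w, enorm (z l w - X vin l w) =
    L2dist (PiL2 (half_step S l vin w)) (PiL2 (S l vin w))}.
  apply: filterS2 (lift_half l) (E0 vin l) => w <- El.
  by rewrite -lift_iso /X /coord_chain liftK.
have sumE : {ae P, forall w,
    N%:R^-1 * (\sum_(0 <= l < N) enorm (z l w - X vin l w) ^+ 2) =
    N%:R^-1 * (\sum_(0 <= l < N)
      L2dist (PiL2 (half_step S l vin w)) (PiL2 (S l vin w)) ^+ 2)}.
  apply: filterS (ae_foralln distE) => w dw.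
  by congr (_ * _); apply: eq_bigr => l _; rewrite dw.
have mY : measurable_fun setT (fun w =>
    N%:R^-1 * (\sum_(0 <= l < N) enorm (z l w - X vin l w) ^+ 2)).
  apply: measurable_funM => //; apply: measurable_sum => l.
  by apply: measurable_funX; apply: measurable_enorm; exact: measurable_mxB.
apply: ae_eq_integral => //.
- exact/measurable_EFinP.
- by apply/measurable_EFinP; exact: (ae_measurable neg sumE mY).
- by apply: filterS sumE => w -> _.
Qed.
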